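(* Let $\varepsilon>0$ be fixed and let $p=p(n)$ satisfy $\log n/n \ll p \ll 1$. Let $G=G_{n,p}$ and let $f:E(G)\to\{1,\ldots,e(G)\}$ be a uniformly random edge ordering of $G$ (chosen after exposing $G$). Then, with high probability, the longest $f$-increasing path in $G$ has length at least $(1-\varepsilon)enp$.
   Context: $G_{n,p}$ is the Erdős–Rényi random graph on $n$ vertices in which each pair of vertices is an edge independently with probability $p$. A path is a sequence of distinct vertices $v_1,\ldots,v_t$ with $v_iv_{i+1}$ an edge for all $i$; its length is its number of edges. Given a bijection $f:E(G)\to\{1,\ldots,e(G)\}$, a path with consecutive edges $e_1,\ldots,e_k$ is $f$-increasing if $f(e_1)<\cdots<f(e_k)$. The notation $a\ll b$ means $a/b\to 0$ as $n\to\infty$. ''With high probability'' means with probability tending to $1$ as $n\to\infty$; $e$ denotes Euler's number. *)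

(* Defs.v *)
From HB Require Import structures.
From mathcomp Require Import all_boot all_order all_algebra.
From mathcomp Require Import all_classical all_reals all_analysis.

Set Implicit Arguments.
Unset Strict Implicit.
Unset Printing Implicit Defensive.

Import Order.TTheory GRing.Theory Num.Theory.
Import numFieldNormedType.Exports.

Local Open Scope classical_set_scope.
Local Open Scope ring_scope.

(* A graph with vertex set 'I_n is given by its edge set E, a set of
   two-element subsets of 'I_n. *)
Definition pairs (n : nat) : {set {set 'I_n}} := [set e : {set 'I_n} | #|e| == 2%N].

(* The values of an edge labelling lie in {0, ..., e(G) - 1} instead of
   {1, ..., e(G)}; [label] performs the shift. *)
Definition labelling (n : nat) (E : {set {set 'I_n}}) :=
  {ffun {e : {set 'I_n} | e \in E} -> 'I_#|E|}.

Definition edge_orderings (n : nat) (E : {set {set 'I_n}}) :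
    {set labelling E} :=
  [set f : labelling E | `[< bijective f >]].

(* Non-edges get the junk value 0. *)
Definition label (n : nat) (E : {set {set 'I_n}}) (f : labelling E)
    (e : {set 'I_n}) : nat :=
  if insub e is Some e' then (f e').+1 else 0%N.

Definition is_path (n : nat) (E : {set {set 'I_n}}) (v : seq 'I_n) : bool :=
  uniq v && sorted (fun x y => [set x; y]%SET \in E) v.

Definition path_edges (n : nat) (v : seq 'I_n) : seq {set 'I_n} :=
  [seq [set xy.1; xy.2]%SET | xy <- zip v (behead v)].

Definition increasing_path (n : nat) (E : {set {set 'I_n}}) (f : labelling E)
    (v : seq 'I_n) : bool :=
  is_path E v && sorted ltn [seq label f e | e <- path_edges v].

(* A path with k edges has k + 1 distinct vertices, hence k < n. *)
Definition longest_increasing_path (n : nat) (E : {set {set 'I_n}})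
    (f : labelling E) : nat :=
  (\max_(k < n | [exists v : k.+1.-tuple 'I_n, increasing_path f v]) k)%N.

Section RandomOrderedGraph.
Variable R : realType.

Definition Gnp_weight (n : nat) (p : R) (E : {set {set 'I_n}}) : R :=
  \prod_(e in pairs n) (if e \in E then p else 1 - p).

Definition ordering_prob (n : nat) (E : {set {set 'I_n}})
    (A : pred (labelling E)) : R :=
  #|[set f in edge_orderings E | A f]%SET|%:R / #|edge_orderings E|%:R.

(* Probability of A (G, f) for G = G_{n,p} and, given G, f a uniformly random
   edge ordering of G. *)
Definition ordered_Gnp_prob (n : nat) (p : R)
    (A : forall E : {set {set 'I_n}}, pred (labelling E)) : R :=
  \sum_(E : {set {set 'I_n}} | E \subset pairs n)
    Gnp_weight p E * ordering_prob (A E).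

(* The first conjunct makes a / b meaningful: division by 0 yields 0 here. *)
Definition much_less (a b : nat -> R) : Prop :=
  (\forall n \near \oo, b n != 0) /\ (a n / b n @[n --> \oo] --> (0 : R)).

Definition whp (Pr : nat -> R) : Prop := Pr n @[n --> \oo] --> (1 : R).

End RandomOrderedGraph.

(* Main.v *)
(** Draw the graph in N rounds, each an independent G_{n,q} with
    (1 - q)^N = 1 - p, and order the edges by the first round that draws them,
    ties at random: by exchangeability this is G_{n,p} with a uniform edge
    ordering, so it suffices to find a path along which the rounds strictly
    increase.  Let A_k, for k = 0, ..., l, consist of endpoints of increasing
    paths of length L l + k.  In a round each pair from A_k to an unused vertex
    is drawn with probability about 1 / (n Q), so A_{k+1} gains |A_k| / Q
    vertices; starting from A_0 alone, |A_k| is M C(t, k) Q^(l - k) after t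
    rounds.  If C(T, l) >= Q^l, then A_l is after T rounds as large as A_0 was,
    and one starts again with L + 1; here l Q / T can be made as close to e as
    we like.  Hence every T of the about n p Q rounds gain l edges, in total
    about e n p.  Only O(n p) = o(n) vertices are ever used, and by Chebyshev's
    inequality a round fails with probability O(1 / M), which costs at most one
    block of T rounds. *)

Require Import Defs.
From HB Require Import structures.
From mathcomp Require Import all_classical all_reals all_analysis.
From mathcomp Require Import all_boot all_fingroup all_order all_algebra.
From mathcomp Require Import ring lra.

Set Implicit Arguments.
Unset Strict Implicit.
Unset Printing Implicit Defensive.

Import Order.TTheory GRing.Theory Num.Theory.

Local Open Scope ring_scope.

(** * Expectations over $G_{n,q}$, second moments and Chebyshev bounds *)

Section BernoulliSubset.
Variables (R : realType) (n : nat).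
Implicit Types (p q : R) (D E J Y : {set {set 'I_n}}).

Lemma sum_subset_prod D (F : {set 'I_n} -> bool -> R) :
  \sum_(Y : {set {set 'I_n}} | Y \subset D) \prod_(e in D) F e (e \in Y)
  = \prod_(e in D) (F e true + F e false).
Proof.
rewrite [RHS]big_mkcond /=.
(* An [e] outside [D] gets the factor 0 if chosen and 1 if not, so that distributivity over the
   whole type leaves only the subsets of [D]. *)
transitivity (\prod_(e : {set 'I_n})
   ((if e \in D then F e true else 0) + (if e \in D then F e false else 1))).
  rewrite bigA_distr [LHS]big_mkcond; apply: eq_bigr => Y _.
  case: ifPn => [sYD|/subsetPn[e eY eD]]; last first.
    by rewrite (bigD1 e) //= eY (negbTE eD) mul0r.
  rewrite [LHS]big_mkcond /=; apply: eq_bigr => e _.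
  have [eY|eY] := boolP (e \in Y); first by rewrite (subsetP sYD _ eY).
  by case: ifP.
by apply: eq_bigr => e _; case: ifP => _ //; rewrite add0r.
Qed.

Definition mean q (F : {set {set 'I_n}} -> R) : R :=
  \sum_(Y : {set {set 'I_n}} | Y \subset pairs n) Gnp_weight q Y * F Y.

Lemma Gnp_weight_ge0 q Y : 0 <= q <= 1 -> 0 <= Gnp_weight q Y.
Proof.
by move=> /andP[q0 q1]; apply: prodr_ge0 => e _; case: ifP => //; rewrite subr_ge0.
Qed.

Lemma eq_mean q F G : (forall Y, Y \subset pairs n -> F Y = G Y) ->
  mean q F = mean q G.
Proof. by move=> FG; apply: eq_bigr => Y sY; rewrite FG. Qed.

Lemma le_mean q F G : 0 <= q <= 1 ->
  (forall Y, Y \subset pairs n -> F Y <= G Y) -> mean q F <= mean q G.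
Proof. by move=> q01 FG; apply: ler_sum => Y sY; rewrite ler_wpM2l ?FG ?Gnp_weight_ge0. Qed.

Lemma meanD q F G : mean q (fun Y => F Y + G Y) = mean q F + mean q G.
Proof. by rewrite -big_split; apply: eq_bigr => Y _; rewrite mulrDr. Qed.

Lemma meanZ q c F : mean q (fun Y => c * F Y) = c * mean q F.
Proof. by rewrite mulr_sumr; apply: eq_bigr => Y _; rewrite mulrCA. Qed.

Lemma mean_sum q (I : finType) (P : pred I) (F : I -> {set {set 'I_n}} -> R) :
  mean q (fun Y => \sum_(i | P i) F i Y) = \sum_(i | P i) mean q (F i).
Proof. by rewrite exchange_big; apply: eq_bigr => Y _; rewrite mulr_sumr. Qed.

Lemma mean1 q : mean q (fun=> 1) = 1.
Proof.
transitivity (\sum_(Y : {set {set 'I_n}} | Y \subset pairs n)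
  \prod_(e in pairs n) (if e \in Y then q else 1 - q)).
  by apply: eq_bigr => Y _; rewrite mulr1.
rewrite (sum_subset_prod _ (fun _ b => if b then q else 1 - q)).
by rewrite big1 // => e _; rewrite addrC subrK.
Qed.

Lemma mean_cst q c : mean q (fun=> c) = c.
Proof. by rewrite -[RHS]mulr1 -(mean1 q) -meanZ; apply: eq_mean => Y _; rewrite mulr1. Qed.

Lemma mean_subset q J : J \subset pairs n ->
  mean q (fun Y => (J \subset Y)%:R) = q ^+ #|J|.
Proof.
move=> sJ.
transitivity (\sum_(Y : {set {set 'I_n}} | Y \subset pairs n)
  \prod_(e in pairs n)
    ((if e \in Y then q else 1 - q) * ((e \in J) ==> (e \in Y))%:R)).
  apply: eq_bigr => Y _; rewrite big_split /=; congr (_ * _).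
  case: (boolP (J \subset Y)) => [sJY|/subsetPn[e eJ eY]].
    by rewrite big1 // => e _; case: (boolP (e \in J)) => //= /(subsetP sJY) ->.
  by rewrite (bigD1 e) ?(subsetP sJ) //= eJ (negbTE eY) mul0r.
rewrite (sum_subset_prod _
  (fun e b => (if b then q else 1 - q) * ((e \in J) ==> b)%:R)) /=.
rewrite -prodr_const [RHS]big_mkcond [LHS]big_mkcond; apply: eq_bigr => e _.
rewrite implybT mulr1; case: (boolP (e \in J)) => [/(subsetP sJ) ->|_] /=.
  by rewrite mulr0 addr0.
by rewrite mulr1 addrC subrK if_same.
Qed.

Lemma mean_in q e : e \in pairs n -> mean q (fun Y => (e \in Y)%:R) = q.
Proof.
move=> eP; rewrite -[RHS]expr1 -(cards1 e) -mean_subset ?sub1set //.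
by apply: eq_mean => Y _; rewrite sub1set.
Qed.

Lemma mean_in2 q e e' : e \in pairs n -> e' \in pairs n -> e != e' ->
  mean q (fun Y => ((e \in Y) && (e' \in Y))%:R) = q ^+ 2.
Proof.
move=> eP e'P ee'; have <- : #|[set e; e']%SET| = 2%N by rewrite cards2 ee'.
rewrite -mean_subset; first by apply: eq_mean => Y _; rewrite subUset !sub1set.
by rewrite subUset !sub1set eP.
Qed.

Lemma card_setI_sum Y D : #|Y :&: D|%:R = \sum_(e in D) (e \in Y)%:R :> R.
Proof.
rewrite -sum1_card natr_sum big_mkcond [RHS]big_mkcond; apply: eq_bigr => e _.
by rewrite inE andbC; case: (e \in D); case: (e \in Y).
Qed.

(** In the expanded square the diagonal terms have mean [q] and the others [q ^+ 2]; adding [q ^+ 2]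
    on the diagonal as well turns the latter into the square of the mean. *)
Lemma variance_card q D : 0 <= q <= 1 -> D \subset pairs n ->
  mean q (fun Y => (#|Y :&: D|%:R - q * #|D|%:R) ^+ 2) <= q * #|D|%:R.
Proof.
move=> q01 sD.
have m1 : mean q (fun Y => #|Y :&: D|%:R) = q * #|D|%:R.
  rewrite (eq_mean _ (fun Y _ => card_setI_sum Y D)) mean_sum.
  rewrite (eq_bigr (fun=> q)) => [|e eD]; last by rewrite mean_in ?(subsetP sD).
  by rewrite sumr_const mulr_natr.
have m2 : mean q (fun Y => #|Y :&: D|%:R ^+ 2) =
    \sum_(e in D) \sum_(e' in D) (if e == e' then q else q ^+ 2).
  transitivity (mean q (fun Y =>
      \sum_(e in D) \sum_(e' in D) ((e \in Y) && (e' \in Y))%:R)).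
    apply: eq_mean => Y _; rewrite card_setI_sum expr2 mulr_suml.
    apply: eq_bigr => e _; rewrite mulr_sumr; apply: eq_bigr => e' _.
    by rewrite -natrM mulnb.
  rewrite mean_sum; apply: eq_bigr => e eD; rewrite mean_sum.
  apply: eq_bigr => e' e'D; case: eqVneq => [<-|ee'].
    by rewrite -[RHS](mean_in q (subsetP sD _ eD)); apply: eq_mean => Y _; rewrite andbb.
  by rewrite mean_in2 ?(subsetP sD).
have {}m2 : mean q (fun Y => #|Y :&: D|%:R ^+ 2) <= q * #|D|%:R + (q * #|D|%:R) ^+ 2.
  rewrite m2.
  apply: (@le_trans _ _ (\sum_(e in D) (q + q ^+ 2 * #|D|%:R))).
    apply: ler_sum => e eD; rewrite (bigD1 e) //= eqxx lerD2l.
    rewrite (eq_bigr (fun=> q ^+ 2)) => [|e' /andP[_ e'e]]; last first.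
      by rewrite eq_sym (negbTE e'e).
    rewrite mulr_natr -sumr_const [leRHS](bigD1 e) //= lerDr.
    by rewrite exprn_ge0 //; case/andP: q01.
  by rewrite sumr_const -[leLHS]mulr_natr; rewrite le_eqVlt; apply/orP; left; apply/eqP; ring.
set a := q * _ in m1 m2 *.
rewrite (@eq_mean _ _ (fun Y => #|Y :&: D|%:R ^+ 2 + (- 2 * a * #|Y :&: D|%:R + a ^+ 2))).
  by rewrite !meanD meanZ mean_cst m1; lra.
by move=> Y _; ring.
Qed.

Lemma markov_mean q (F : {set {set 'I_n}} -> R) (P : pred {set {set 'I_n}}) b :
  0 <= q <= 1 -> 0 < b -> (forall Y, 0 <= F Y) -> (forall Y, P Y -> b <= F Y) ->
  mean q (fun Y => (P Y)%:R) <= mean q F / b.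
Proof.
move=> q01 b0 F0 FP; rewrite ler_pdivlMr // mulrC -meanZ; apply: le_mean => // Y _.
by case: (boolP (P Y)) => [/FP|_]; rewrite ?mulr1 ?mulr0.
Qed.

(** Chebyshev: the event forces a deviation of at least [eta] times the mean, and the variance is at
    most the mean. *)
Lemma card_lower_tail q D (c : nat) (eta : R) : 0 < q <= 1 -> D \subset pairs n ->
    0 < eta -> (0 < #|D|)%N -> c%:R <= (1 - eta) * (q * #|D|%:R) ->
  mean q (fun Y => (#|Y :&: D| < c)%N%:R) <= (eta ^+ 2 * (q * #|D|%:R))^-1.
Proof.
move=> /andP[q0 q1] sD eta0 D0 cle.
have q01 : 0 <= q <= 1 by rewrite ltW.
have a0 : 0 < q * #|D|%:R by rewrite mulr_gt0 // ltr0n.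
apply: le_trans (markov_mean (F := fun Y => (#|Y :&: D|%:R - q * #|D|%:R) ^+ 2)
   (b := (eta * (q * #|D|%:R)) ^+ 2) q01 _ _ _) _.
- by rewrite exprn_gt0 // mulr_gt0.
- by move=> Y; rewrite sqr_ge0.
- move=> Y; rewrite -(ltr_nat R) => Yc.
  have ea0 := mulr_gt0 eta0 a0.
  rewrite -[leRHS]sqrrN ler_sqr ?nnegrE; move: ea0 a0 cle Yc;
    set a := q * _; set x := #|_|%:R => ea0 a0 cle Yc; lra.
apply: le_trans (ler_wpM2r _ (variance_card q01 sD)) _.
  by rewrite invr_ge0 sqr_ge0.
rewrite le_eqVlt; apply/orP; left; apply/eqP; field; rewrite pnatr_eq0 -lt0n D0 !gt_eqF //.
Qed.

Lemma card_upper_tail q D (c : nat) : 0 <= q <= 1 -> D \subset pairs n ->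
    q * #|D|%:R < c%:R ->
  mean q (fun Y => (c <= #|Y :&: D|)%N%:R)
    <= q * #|D|%:R / (c%:R - q * #|D|%:R) ^+ 2.
Proof.
move=> q01 sD clt.
apply: le_trans (markov_mean (F := fun Y => (#|Y :&: D|%:R - q * #|D|%:R) ^+ 2)
   (b := (c%:R - q * #|D|%:R) ^+ 2) q01 _ _ _) _.
- by rewrite exprn_gt0 // subr_gt0.
- by move=> Y; rewrite sqr_ge0.
- move=> Y; rewrite -(ler_nat R) => Yc.
  by rewrite ler_sqr ?nnegrE; lra.
by apply: ler_wpM2r (variance_card q01 sD); rewrite invr_ge0 sqr_ge0.
Qed.

(** Sorted by the value [E] of the union, the joint weight factors over the pairs, and each pair
    contributes $p + q - pq$ or $(1-p)(1-q)$. *)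
Lemma mean_union p q (g : {set {set 'I_n}} -> R) :
  mean p (fun Y => mean q (fun X => g (X :|: Y))) = mean (p + q - p * q) g.
Proof.
(* The factor at [e] is the weight of the choices for [X] that make [X :|: Y] agree with [E] there:
   drawing [e] requires [e \in E], not drawing it requires that [E] and [Y] agree at [e]. *)
transitivity (mean p (fun Y => \sum_(E : {set {set 'I_n}} | E \subset pairs n)
   g E * \prod_(e in pairs n) ((if e \in E then q else 0)
     + (if (e \in E) == (e \in Y) then 1 - q else 0)))).
  apply: eq_mean => Y sY.
  transitivity (mean q (fun X =>
     \sum_(E : {set {set 'I_n}} | E \subset pairs n) g E * (X :|: Y == E)%:R)).
    apply: eq_mean => X sX; rewrite (bigD1 (X :|: Y)) /= ?subUset ?sX //.
    rewrite eqxx mulr1 big1 ?addr0 // => E /andP[_ /negbTE].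
    by rewrite eq_sym => ->; rewrite mulr0.
  rewrite mean_sum; apply: eq_bigr => E sE; rewrite meanZ; congr (_ * _).
  rewrite -(sum_subset_prod _ (fun e b => if b then (if e \in E then q else 0)
     else (if (e \in E) == (e \in Y) then 1 - q else 0))).
  apply: eq_bigr => X sX.
  have [<-|XYE] := eqVneq (X :|: Y) E.
    rewrite mulr1; apply: eq_bigr => e _; rewrite inE.
    by case: (e \in X) => //=; rewrite eqxx.
  rewrite mulr0; apply/esym/eqP/prodf_eq0.
  have [e] : exists e, (e \in X :|: Y) != (e \in E).
    apply/existsP; apply: contraR XYE => /existsPn H; apply/eqP/setP => e.
    by apply/eqP; rewrite -[_ == _]negbK; exact: H.
  move=> He; exists e.
    apply: contraR He => eP; rewrite inE.
    by rewrite !(negbTE (contra (subsetP _ e) eP)).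
  move: He; rewrite inE; case: (e \in X) => /=; first by case: (e \in E).
  by rewrite eq_sym => /negbTE ->.
rewrite mean_sum; apply: eq_bigr => E sE; rewrite meanZ mulrC; congr (_ * _).
transitivity (\sum_(Y : {set {set 'I_n}} | Y \subset pairs n) \prod_(e in pairs n)
   ((if e \in Y then p else 1 - p) * ((if e \in E then q else 0)
     + (if (e \in E) == (e \in Y) then 1 - q else 0)))).
  by apply: eq_bigr => Y _; rewrite big_split.
rewrite (sum_subset_prod _ (fun e b => (if b then p else 1 - p) *
   ((if e \in E then q else 0) + (if (e \in E) == b then 1 - q else 0)))).
by apply: eq_bigr => e _; case: (e \in E) => /=; ring.
Qed.

End BernoulliSubset.

(** * Histories of independent rounds, and their exchangeability *)

Section Histories.
Variables (R : realType) (n : nat).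
Implicit Types (p q : R) (D E Y : {set {set 'I_n}}) (e : {set 'I_n}).
Implicit Types (h : seq {set {set 'I_n}}).

Definition cov h : {set {set 'I_n}} := \big[@setU _/finset.set0]_(Y <- h) Y.

Lemma cov_nil : cov [::] = finset.set0.
Proof. by rewrite /cov big_nil. Qed.

Lemma cov_cons Y h : cov (Y :: h) = Y :|: cov h.
Proof. by rewrite /cov big_cons. Qed.

(* A history lists the sets of edges drawn in successive rounds, newest first;
   [slot h e] is the number, counted from 1, of the first round that drew e,
   and 0 if there is none. *)
Fixpoint slot h e : nat :=
  if h is Y :: h' then
    if e \in cov h' then slot h' e else if e \in Y then (size h').+1 else 0%N
  else 0%N.

Lemma slot_le h e : (slot h e <= size h)%N.
Proof.
by elim: h => //= Y h IH; case: ifP => _; [exact: leqW | case: ifP].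
Qed.

Fixpoint expect q j h (F : seq {set {set 'I_n}} -> R) : R :=
  if j is j'.+1 then mean q (fun Y => expect q j' (Y :: h) F) else F h.

Lemma le_expect q j h F G : 0 <= q <= 1 -> (forall h', F h' <= G h') ->
  expect q j h F <= expect q j h G.
Proof.
by move=> q01 FG; elim: j h => //= j IH h; apply: le_mean => // Y _; exact: IH.
Qed.

(* Rounds are appended one at a time, so a property of the starting history
   that each round preserves may be assumed of the final one. *)
Lemma le_expect_inv (I : nat -> seq {set {set 'I_n}} -> Prop) q j h F G :
  0 <= q <= 1 -> I j h ->
  (forall i h' Y, I i.+1 h' -> Y \subset pairs n -> I i (Y :: h')) ->
  (forall h', I 0%N h' -> F h' <= G h') ->
  expect q j h F <= expect q j h G.
Proof.
move=> q01 + II FG; elim: j h => [|j IH] h Ih /=; first exact: FG.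
by apply: le_mean => // Y sY; apply: IH; apply: II.
Qed.

Lemma expectD q j h F G :
  expect q j h (fun h' => F h' + G h') = expect q j h F + expect q j h G.
Proof.
by elim: j h => //= j IH h; rewrite -meanD; apply: eq_mean => Y _; exact: IH.
Qed.

Lemma expectZ q j h c F : expect q j h (fun h' => c * F h') = c * expect q j h F.
Proof.
by elim: j h => //= j IH h; rewrite -meanZ; apply: eq_mean => Y _; exact: IH.
Qed.

Lemma expect_cst q j h c : expect q j h (fun=> c) = c.
Proof.
elim: j h => //= j IH h; rewrite -[RHS](mean_cst n q); apply: eq_mean => Y _.
exact: IH.
Qed.

Lemma expect_sum q j h (I : finType) (P : pred I) F :
  expect q j h (fun h' => \sum_(i | P i) F i h') = \sum_(i | P i) expect q j h (F i).
Proof.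
elim: j h => //= j IH h; rewrite -mean_sum; apply: eq_mean => Y _; exact: IH.
Qed.

Lemma expect_add q i j h F :
  expect q (i + j) h F = expect q i h (fun h' => expect q j h' F).
Proof. by elim: i h => //= i IH h; apply: eq_mean => Y _; exact: IH. Qed.

(** By [mean_union], each further round multiplies by [1 - q] the probability that a given pair is
    still undrawn. *)
Lemma expect_cov q j h g :
  expect q j h (fun h' => g (cov h'))
  = mean (1 - (1 - q) ^+ j) (fun Y => g (Y :|: cov h)).
Proof.
elim: j h g => [|j IH] h g /=.
  (* At edge probability 0 only the empty set has nonzero weight. *)
  rewrite expr0 subrr; rewrite (@eq_mean _ _ _ _
    (fun Y => g (cov h) * (Y == finset.set0)%:R + g (Y :|: cov h) * (Y != finset.set0)%:R)).
    rewrite meanD meanZ.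
    have -> : mean 0 (fun Y => (Y == finset.set0)%:R) = 1 :> R.
      rewrite /mean (bigD1 finset.set0) ?sub0set //= eqxx mulr1 big1 ?addr0.
        by rewrite /Gnp_weight big1 // => e _; rewrite inE subr0.
      by move=> Y /andP[_ /negbTE ->]; rewrite mulr0.
    rewrite mulr1 /mean big1 ?addr0 // => Y sY.
    have [->|/set0Pn[e eY]] := eqVneq Y finset.set0; first by rewrite !mulr0.
    by rewrite /Gnp_weight (bigD1 e) ?(subsetP sY) //= eY mul0r mul0r.
  by move=> Y _; case: eqVneq => [->|_]; rewrite ?set0U ?mulr1 ?mulr0 ?addr0 ?add0r.
rewrite (eq_mean _ (fun Y _ => IH (Y :: h) g)).
transitivity (mean q (fun Y => mean (1 - (1 - q) ^+ j)
   (fun X => g ((X :|: Y) :|: cov h)))).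
  by apply: eq_mean => Y _; apply: eq_mean => X _; rewrite cov_cons setUA.
rewrite (mean_union _ _ (fun Z => g (Z :|: cov h))); congr (mean _ _).
by rewrite exprS; ring.
Qed.

Section Relabelling.
Variable s : {perm {set 'I_n}}.
Hypothesis s_pairs : s @: pairs n = pairs n.

(** All pairs carry the same factor, so the law is invariant under every permutation of the pairs,
    not only under those induced by permuting vertices. *)
Lemma mean_perm q F : mean q (fun Y => F (s @: Y)) = mean q F.
Proof.
rewrite /mean [RHS](reindex_inj (h := fun Y => s @: Y)) /=; last first.
  by apply: imset_inj; apply: perm_inj.
rewrite [RHS](eq_bigl (fun Y : {set {set 'I_n}} => Y \subset pairs n)) => [|Y].
  2: {
    apply/idP/idP => [/subsetP sY|/(imsetS s)]; last by rewrite s_pairs.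
    apply/subsetP => e eY; have := sY (s e); rewrite (mem_imset _ _ (@perm_inj _ s)) => /(_ eY).
    by rewrite -{1}s_pairs (mem_imset _ _ (@perm_inj _ s)).
  }
apply: eq_bigr => Y _; congr (_ * _).
rewrite /Gnp_weight -[in RHS]s_pairs big_imset => [|? ? _ _]; last exact: perm_inj.
by apply: eq_bigr => e _; rewrite mem_imset //; exact: perm_inj.
Qed.

Definition relabel h := [seq s @: Y | Y : {set {set 'I_n}} <- h].

Lemma expect_perm q j h F :
  expect q j h (F \o relabel) = expect q j (relabel h) F.
Proof.
elim: j h => //= j IH h.
rewrite -[RHS]mean_perm; apply: eq_mean => Y _; exact: IH.
Qed.

Lemma cov_relabel h : cov (relabel h) = s @: cov h.
Proof.
elim: h => [|Y h IH]; first by rewrite cov_nil imset0.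
by rewrite /= !cov_cons IH imsetU.
Qed.

Lemma slot_relabel h e : slot (relabel h) (s e) = slot h e.
Proof.
by elim: h => //= Y h IH; rewrite cov_relabel !mem_imset ?IH ?size_map //; exact: perm_inj.
Qed.

End Relabelling.

End Histories.

(** * From histories to uniformly ordered random graphs *)

Section Coupling.
Variables (R : realType) (n : nat).
Implicit Types (p q : R) (E Y : {set {set 'I_n}}) (e : {set 'I_n}).
Implicit Types (h : seq {set {set 'I_n}}) (v : seq 'I_n).

(* Paths are traversed backwards, as histories are. *)
Definition timed_path h v : bool :=
  [&& uniq v, all (mem (cov h)) (path_edges v)
    & sorted gtn [seq slot h e | e <- path_edges v]].

Lemma path_edges_cons2 (x y : 'I_n) v :
  path_edges (x :: y :: v) = [set x; y]%SET :: path_edges (y :: v).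
Proof. by []. Qed.

Lemma path_edges_rcons2 (x y : 'I_n) v :
  path_edges (rcons (rcons v y) x) = rcons (path_edges (rcons v y)) [set y; x]%SET.
Proof.
elim: v => [|a [|b v] IH] //.
by move: IH; rewrite !rcons_cons => IH; rewrite path_edges_cons2 IH.
Qed.

Lemma path_edges_rev v : path_edges (rev v) = rev (path_edges v).
Proof.
elim: v => [|x [|y v] IH] //; rewrite path_edges_cons2 !rev_cons.
by rewrite path_edges_rcons2 -rev_cons IH setUC.
Qed.

Lemma is_path_edges E v : is_path E v = uniq v && all (mem E) (path_edges v).
Proof.
rewrite /is_path; congr (_ && _); elim: v => [|x [|y v] IH] //.
by rewrite path_edges_cons2 [RHS]/= -IH.
Qed.

Lemma label_val E (f : labelling E) (x : {e : {set 'I_n} | e \in E}) :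
  label f (val x) = (f x).+1.
Proof. by rewrite /label valK. Qed.

(** Edges first drawn in the same round may come in either order. *)
Definition compatible h E (f : labelling E) :=
  forall x y : {e : {set 'I_n} | e \in E},
    (slot h (val x) < slot h (val y))%N -> (f x < f y)%N.

(** Slots decrease strictly along [v], so the labels of a compatible ordering increase strictly
    along [rev v], which has [c] edges. *)
Lemma longest_increasing_path_timed h E (f : labelling E) v c :
    cov h = E -> compatible h f -> timed_path h v -> size v = c.+1 ->
  (c <= longest_increasing_path f)%N.
Proof.
move=> covE; move: f; rewrite -{E}covE => f fh /and3P[uv av sv] sz_v.
have c_lt : (c < n)%N by have := max_card (mem v); rewrite (card_uniqP uv) sz_v card_ord.
have := @leq_bigmax_cond _ (fun k : 'I_n =>
  [exists v : k.+1.-tuple 'I_n, increasing_path f v]) (fun k => k : nat) (Ordinal c_lt).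
apply; apply/existsP => /=.
have sz_rv : size (rev v) == c.+1 by rewrite size_rev sz_v.
exists (Tuple sz_rv); rewrite /increasing_path /= is_path_edges path_edges_rev.
rewrite rev_uniq uv all_rev av /= map_rev rev_sorted.
move: sv av; elim: (path_edges v) => //= e [|e' s] IH //= /andP[ee' es] /and3P[eE e'E sE].
have {}IH : path (fun x y => (y < x)%N) (label f e') [seq label f i | i <- s].
  by apply: IH => //; apply/andP; split.
apply/andP; split=> //; move: ee'.
by move/(fh (exist _ e' e'E) (exist _ e eE)); rewrite /= -ltnS -!label_val.
Qed.

Lemma card_sig_set E : #|{: {e : {set 'I_n} | e \in E}}| = #|E|.
Proof. by rewrite card_sig; apply: eq_card. Qed.

Lemma edge_ordering_inj E (f : labelling E) :
  injective f -> f \in edge_orderings E.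
Proof.
move=> f_inj; rewrite inE; apply/asboolP.
by apply: inj_card_bij => //; rewrite card_ord card_sig_set.
Qed.

(** Sort the edges by slot and label each with its position. *)
Lemma exists_compatible h E :
  exists2 f : labelling E, f \in edge_orderings E & compatible h f.
Proof.
pose le (x y : {e : {set 'I_n} | e \in E}) := (slot h (val x) <= slot h (val y))%N.
pose s := sort le (enum {: {e : {set 'I_n} | e \in E}}).
have in_s x : x \in s by rewrite mem_sort mem_enum.
have lt_s x : (index x s < #|E|)%N.
  by rewrite -card_sig_set cardE -(size_sort le) index_mem.
exists [ffun x => Ordinal (lt_s x)].
  apply: edge_ordering_inj => x y; rewrite !ffunE => /(congr1 val) /=.
  by move/(congr1 (nth x s)); rewrite !nth_index.
move=> x y xy; rewrite !ffunE /= ltnNge; apply/negP => yx.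
suff : le y x by rewrite /le leqNgt xy.
apply: (@sorted_leq_index _ le _ _ s) => //.
- by move=> a b c; exact: leq_trans.
- by move=> a; exact: leqnn.
- by apply: sort_sorted => a b; exact: leq_total.
Qed.

Lemma card_edge_orderings E : (#|edge_orderings E| <= (#|E|)`!)%N.
Proof.
have := card_inj_ffuns {e : {set 'I_n} | e \in E} 'I_#|E|.
rewrite card_ord card_sig_set ffactnn => <-.
apply: subset_leq_card; apply/subsetP => f; rewrite !inE => /asboolP /bij_inj ?.
exact/injectiveP.
Qed.

Definition long_timed c h := [exists v : c.+1.-tuple 'I_n, timed_path h v].

Lemma perm_onV E (s : {perm {set 'I_n}}) : perm_on E s -> perm_on E s^-1%g.
Proof.
move=> sE; apply/subsetP => e; rewrite inE.
by apply: contraR => /(out_perm sE) {1}<-; rewrite permK.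
Qed.

(* Pulling a compatible ordering back along the permutations of E gives, for
   each of them, a different ordering of E. *)
Lemma card_long_timed c h E : cov h = E ->
  (#|[set s | perm_on E s & long_timed c (relabel s h)]%SET|
   <= #|[set f in edge_orderings E | (c <= longest_increasing_path f)%N]%SET|)%N.
Proof.
move=> covE; have [f fE fh] := exists_compatible h E.
have f_inj : injective f by move: fE; rewrite inE => /asboolP /bij_inj.
pose F (s : {perm {set 'I_n}}) : labelling E :=
  [ffun x => f (insubd x ((s^-1)%g (val x)))].
have valF s (x : {e : {set 'I_n} | e \in E}) : perm_on E s ->
    val (insubd x ((s^-1)%g (val x))) = (s^-1)%g (val x).
  move=> sE; have xE : (s^-1)%g (val x) \in E.
    by case: x => e eE; rewrite (perm_closed _ (perm_onV sE)).
  by rewrite val_insubd ifT.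
have F_inj : {in [set s | perm_on E s & long_timed c (relabel s h)]%SET &, injective F}.
  move=> s t; rewrite !inE => /andP[sE _] /andP[tE _] Fst.
  apply: invg_inj; apply/permP => e.
  have [eE|eE] := boolP (e \in E); last by rewrite !(out_perm (perm_onV _) eE).
  have := congr1 (fun g : labelling E => g (exist _ e eE)) Fst.
  by rewrite !ffunE => /f_inj /(congr1 val); rewrite !valF.
rewrite -(card_in_imset F_inj); apply: subset_leq_card.
apply/subsetP => _ /imsetP[s + ->]; rewrite !inE => /andP[sE /existsP[v tv]].
have -> : `[< bijective (F s) >].
  have: F s \in edge_orderings E; last by rewrite inE.
  apply: edge_ordering_inj => x y; rewrite !ffunE => /f_inj /(congr1 val).
  by rewrite !valF // => /perm_inj /val_inj.
apply: (longest_increasing_path_timed _ _ tv); rewrite ?size_tuple //.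
  by rewrite cov_relabel covE im_perm_on.
move=> x y; rewrite !ffunE -{1}(permKV s (val x)) -{1}(permKV s (val y)).
by rewrite !slot_relabel => xy; apply: fh; rewrite !valF.
Qed.

(** Given that the rounds unite to [E], relabelling by a permutation of [E] preserves the law of the
    history. The probability of a long path is thus an average over all |E|! relabellings, and
    [card_long_timed] bounds, history by history, how many of them succeed. *)
Lemma Gnp_prob_long_timed q N c : 0 <= q <= 1 ->
  expect q N [::] (fun h => (long_timed c h)%:R)
  <= ordered_Gnp_prob (1 - (1 - q) ^+ N)
       (fun E (f : labelling E) => (c <= longest_increasing_path f)%N).
Proof.
move=> q01.
rewrite (@le_trans _ _ (\sum_(E : {set {set 'I_n}} | E \subset pairs n)
   expect q N [::] (fun h => (cov h == E)%:R * (long_timed c h)%:R))) //.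
  rewrite -expect_sum; apply: (@le_expect_inv _ _ (fun _ h => cov h \subset pairs n)) => //.
  - by rewrite cov_nil sub0set.
  - by move=> _ h Y hP YP; rewrite cov_cons subUset YP.
  - move=> h hP; rewrite (bigD1 (cov h)) //= eqxx mul1r lerDl.
    by apply: sumr_ge0 => E _; rewrite mulr_ge0.
apply: ler_sum => E sE.
set A := [set f in edge_orderings E | (c <= longest_increasing_path f)%N]%SET.
have wE : expect q N [::] (fun h => (cov h == E)%:R) = Gnp_weight (1 - (1 - q) ^+ N) E.
  rewrite (expect_cov q N [::] (fun X => (X == E)%:R)) cov_nil /mean (bigD1 E) //=.
  rewrite setU0 eqxx mulr1 big1 ?addr0 // => Y /andP[_ /negbTE YE].
  by rewrite setU0 YE mulr0.
have fact_gt0 : 0 < ((#|E|)`!)%:R :> R by rewrite ltr0n fact_gt0.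
have orderings_gt0 : 0 < #|edge_orderings E|%:R :> R.
  have [f fE _] := exists_compatible [::] E.
  by rewrite ltr0n; apply/card_gt0P; exists f.
have w0 : 0 <= Gnp_weight (1 - (1 - q) ^+ N) E.
  apply: Gnp_weight_ge0; case/andP: q01 => q0 q1.
  rewrite subr_ge0 exprn_ile1 ?subr_ge0 //=; last by rewrite gerBl.
  by rewrite gerBl exprn_ge0 // subr_ge0.
apply: (@le_trans _ _ (Gnp_weight (1 - (1 - q) ^+ N) E * (#|A|%:R / ((#|E|)`!)%:R))).
  rewrite mulrA ler_pdivlMr // -wE -card_perm.
  rewrite [leRHS]mulrC -[leRHS]expectZ.
  apply: (@le_trans _ _ (\sum_(s | perm_on E s)
     expect q N [::] (fun h => (cov h == E)%:R * (long_timed c h)%:R))).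
    by rewrite sumr_const mulr_natr.
  apply: (@le_trans _ _ (\sum_(s | perm_on E s)
     expect q N [::] (fun h => (cov h == E)%:R * (long_timed c (relabel s h))%:R))).
    apply: ler_sum => s sP.
    have s_pairs : s @: pairs n = pairs n.
      by apply: im_perm_on; apply: subset_trans sP sE.
    rewrite -(expect_perm s_pairs q N [::]) /=; apply: le_expect => // h /=.
    rewrite cov_relabel -{1}(im_perm_on sP).
    by rewrite (inj_eq (imset_inj (@perm_inj _ s))).
  rewrite -expect_sum; apply: le_expect => // h.
  rewrite -mulr_sumr mulrC; have [covE|] := eqVneq (cov h) E; last by rewrite !mulr0.
  rewrite !mulr1; apply: le_trans (_ : #|[set s | perm_on E s & long_timed c (relabel s h)]%SET|%:R <= _).
    rewrite -sum1_card natr_sum big_mkcond [leRHS]big_mkcond /=.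
    by apply: ler_sum => s _; rewrite inE; case: (perm_on E s) => //=; case: long_timed.
  by rewrite ler_nat; exact: card_long_timed.
(* There are at most |E|! orderings, so dividing by their number instead can only increase the
   quotient. *)
rewrite ler_wpM2l // /ordering_prob ler_wpM2l //.
by rewrite lef_pV2 // ler_nat card_edge_orderings.
Qed.

End Coupling.

(** * Families of increasing paths and their growth in one round *)

Section Configurations.
Variable n : nat.
Implicit Types (Y : {set {set 'I_n}}) (h : seq {set {set 'I_n}}) (v : seq 'I_n).
Implicit Types (u w : 'I_n) (W : {set 'I_n}).

Lemma timed_path_mono Y h v : timed_path h v -> timed_path (Y :: h) v.
Proof.
case/and3P=> uv /allP av sv; apply/and3P; split=> //.
  by apply/allP => e /av /= eh; rewrite cov_cons inE eh orbT.
rewrite (@eq_in_map _ _ _ (slot h) _).1 // => e /av /= eh.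
by rewrite eh.
Qed.

(** The new edge is first drawn in round [(size h).+1], later than every slot on the old path. *)
Lemma timed_path_extend Y h u v w : timed_path h (u :: v) -> w \notin u :: v ->
    [set u; w]%SET \in Y -> [set u; w]%SET \notin cov h ->
  timed_path (Y :: h) (w :: u :: v).
Proof.
move=> tv wv uwY uwh; have /and3P[uv av sv] := timed_path_mono Y tv.
apply/and3P; split; first by rewrite cons_uniq wv.
  by rewrite path_edges_cons2 /= av cov_cons inE setUC uwY.
rewrite path_edges_cons2 map_cons; case/and3P: tv => _ /allP av' _.
case: (path_edges (u :: v)) av' sv => [|e s] av' //= ->; rewrite andbT.
have eh : e \in cov h by apply: av'; exact: mem_head.
by rewrite eh setUC (negbTE uwh) uwY ltnS slot_le.
Qed.

Lemma exists_subset_card (I : finType) (B : {set I}) c : (c <= #|B|)%N ->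
  exists2 C : {set I}, C \subset B & #|C| = c.
Proof.
move=> cB; exists [set x in take c (enum B)]%SET.
  by apply/subsetP => x; rewrite inE => /mem_take; rewrite mem_enum.
rewrite cardsE (card_uniqP _) ?take_uniq ?enum_uniq // size_take -cardE.
by case: ltngtP cB.
Qed.

(** A pair keeps its first slot when it is drawn again, so pairs already drawn are lost to later
    rounds. *)
Definition dead_degree h u : nat := #|[set w | [set u; w]%SET \in cov h]%SET|.

Definition fresh_pairs h W (A : {set 'I_n}) : {set {set 'I_n}} :=
  [set [set x.1; x.2]%SET | x in
     [set x : 'I_n * 'I_n | [&& x.1 \in A, x.2 \notin W & [set x.1; x.2]%SET \notin cov h]]%SET]%SET.

Lemma fresh_pairs_sub h W (A : {set 'I_n}) : A \subset W -> fresh_pairs h W A \subset pairs n.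
Proof.
move=> AW; apply/subsetP => _ /imsetP[[u w] /= + ->].
rewrite !inE /= => /and3P[uA wW _]; rewrite cards2.
suff -> : u != w by [].
by apply: contraNneq wW => <-; exact: (subsetP AW).
Qed.

Lemma card_fresh_pairs h W (A : {set 'I_n}) d : A \subset W ->
    (forall u, (dead_degree h u <= d)%N) ->
  (#|A| * (n - (#|W| + d)) <= #|fresh_pairs h W A|)%N.
Proof.
(* A fresh pair determines which end is which: one lies in [A], hence in [W], and the other outside
   [W]. *)
move=> AW dh; rewrite card_in_imset => [|[u w] [u' w']]; last first.
  rewrite !inE /= => /and3P[uA wW _] /and3P[u'A w'W _] /setP eq_uw.
  have /esym := eq_uw u; have := eq_uw w; rewrite !inE !eqxx orbT /=.
  have uW := subsetP AW _ uA; have u'W := subsetP AW _ u'A.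
  have /negbTE -> : w != u' by apply: contraNneq wW => ->.
  have /negbTE -> : u != w' by apply: contraTneq uW => ->.
  by rewrite orbF /= => /esym/eqP -> /eqP ->.
rewrite -[leqRHS]sum1_card (eq_bigl (fun x : 'I_n * 'I_n => (x.1 \in A) &&
   ((x.2 \notin W) && ([set x.1; x.2]%SET \notin cov h)))); last by move=> x; rewrite inE.
rewrite -(pair_big_dep (fun u => u \in A)
  (fun u w => (w \notin W) && ([set u; w]%SET \notin cov h)) (fun _ _ => 1%N)) /=.
rewrite -sum_nat_const; apply: leq_sum => u uA; rewrite sum1_card.
rewrite leq_subLR; apply: (@leq_trans (#|W :|: [set w | [set u; w]%SET \in cov h]%SET| +
    #|[pred w | (w \notin W) && ([set u; w]%SET \notin cov h)]|)).
  rewrite -{1}(card_ord n) -(cardC (mem (W :|: [set w | [set u; w]%SET \in cov h]%SET))).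
  rewrite leq_add2l; apply: subset_leq_card; apply/subsetP => w.
  by rewrite !inE negb_or.
by rewrite leq_add2r (leq_trans (leq_card_setU _ _)) // leq_add2l dh.
Qed.

Definition collision Y W (A : {set 'I_n}) : bool :=
  [exists w, exists u, exists u', [&& w \notin W, u \in A, u' \in A, u != u',
     [set u; w]%SET \in Y & [set u'; w]%SET \in Y]].

Definition newcomers Y h W (A : {set 'I_n}) : {set 'I_n} :=
  [set w | (w \notin W) && [exists u in A,
     ([set u; w]%SET \in Y) && ([set u; w]%SET \notin cov h)]]%SET.

(** Without collisions [Y] joins a newcomer to a single vertex of [A], so [g] recovers every drawn
    fresh pair from its newcomer. *)
Lemma card_newcomers Y h W (A : {set 'I_n}) : ~~ collision Y W A ->
  (#|Y :&: fresh_pairs h W A| <= #|newcomers Y h W A|)%N.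
Proof.
move=> nc.
pose g w : {set 'I_n} := if [pick u in A | ([set u; w]%SET \in Y)] is Some u
  then [set u; w]%SET else finset.set0.
apply: leq_trans (leq_imset_card g _); apply: subset_leq_card.
apply/subsetP => e; rewrite inE => /andP[eY /imsetP[[u w] /=]].
rewrite inE /= => /and3P[uA wW uwh] def_e; rewrite def_e in eY *.
apply/imsetP; exists w.
  by rewrite inE wW; apply/existsP; exists u; rewrite uA eY.
rewrite /g; case: pickP => [u' /andP[u'A u'Y]|/(_ u)]; last by rewrite uA eY.
have [-> //|u'u] := eqVneq u' u; case/negP: nc.
apply/existsP; exists w; apply/existsP; exists u; apply/existsP; exists u'.
by rewrite wW uA u'A eq_sym u'u eY u'Y.
Qed.

Variables l Q T M rho : nat.

(* By Pascal's rule, the (k+1)-st of these sizes grows in every round by 1 / Q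
   times the k-th. *)
Definition stratum t k := (M * 'C(t, k) * Q ^ (l - k))%N.

Hypothesis Q_gt0 : (0 < Q)%N.
Hypothesis rho_ge : (\sum_(k < l.+1) stratum T k <= rho)%N.

(** The division is exact, since [k < l] leaves a factor [Q]. *)
Lemma stratum_div t k : (k < l)%N ->
  (stratum t k %/ Q = M * 'C(t, k) * Q ^ (l - k.+1))%N.
Proof. by move=> kl; rewrite /stratum -(subnSK kl) expnSr mulnA mulnK. Qed.

Lemma stratumS t k : (k < l)%N ->
  stratum t.+1 k.+1 = (stratum t k.+1 + stratum t k %/ Q)%N.
Proof. by move=> kl; rewrite stratum_div // /stratum binS -mulnDl -mulnDr. Qed.

Lemma stratum_mono t k : (t <= T)%N -> (stratum t k <= stratum T k)%N.
Proof. by move=> tT; rewrite leq_mul2r leq_mul2l leq_bin2l ?orbT. Qed.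

Lemma stratum_le t k : (t <= T)%N -> (k <= l)%N -> (stratum t k <= rho)%N.
Proof.
move=> tT kl; apply: leq_trans (stratum_mono k tT) (leq_trans _ rho_ge).
by rewrite (bigD1 (Ordinal (kl : (k < l.+1)%N))) //= leq_addr.
Qed.

(* The vertices of [A k] end increasing paths of length [L * l + k]; the paths
   keep inside [W], so every vertex outside [W] can prolong any of them. *)
Definition config_in W (A : nat -> {set 'I_n}) L t h : Prop :=
  [/\ (L * T + t <= size h)%N, (#|W| <= rho * (size h).+1)%N,
      forall k, (k <= l)%N -> #|A k| = stratum t k
    & forall k u, (k <= l)%N -> u \in A k ->
        exists v, [/\ timed_path h (u :: v), size v = (L * l + k)%N
                    & {subset u :: v <= W}]].

Definition config L t h : Prop := exists W A, config_in W A L t h.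

Lemma config_in_sub W A L t h k : config_in W A L t h -> (k <= l)%N -> A k \subset W.
Proof.
case=> _ _ _ cA kl; apply/subsetP => u /(cA _ _ kl)[v [_ _]]; apply.
exact: mem_head.
Qed.

Lemma config_mono Y L t h : config L t h -> config L t (Y :: h).
Proof.
case=> W [A [Lh Wh cA pA]]; exists W, A; split => //=.
- exact: leqW.
- by apply: leq_trans Wh _; rewrite leq_mul2l leqnSn orbT.
- move=> k u kl /(pA _ _ kl)[v [tv sv vW]]; exists v; split=> //.
  exact: timed_path_mono.
Qed.

(** Each [A k.+1] receives exactly [stratum t k %/ Q] newcomers of the old [A k]; Pascal's rule then
    gives the new sizes, and no path gains two edges in one round. *)
Lemma config_step Y W A L t h : config_in W A L t h -> (t < T)%N ->
    (forall k, (k < l)%N -> ~~ collision Y W (A k)) ->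
    (forall k, (k < l)%N ->
       (stratum t k %/ Q <= #|Y :&: fresh_pairs h W (A k)|)%N) ->
  config L t.+1 (Y :: h).
Proof.
move=> cfg tT nc many; have [Lh Wh cA pA] := cfg.
have ex_C k : exists C : {set 'I_n}, (k < l)%N ->
    C \subset newcomers Y h W (A k) /\ #|C| = (stratum t k %/ Q)%N.
  have [kl|_] := ltnP k l; last by exists finset.set0.
  have [C CN cC] := exists_subset_card (leq_trans (many k kl) (card_newcomers h (nc k kl))).
  by exists C.
have [C HC] := fin_all_exists (fun k : 'I_l => ex_C k).
pose C' k := if insub k is Some i then C i else finset.set0.
have {}HC k : (k < l)%N -> C' k \subset newcomers Y h W (A k) /\ #|C' k| = (stratum t k %/ Q)%N.
  by move=> kl; rewrite /C' insubT; exact: (HC (Ordinal kl)).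
pose A' k := if k is k'.+1 then A k :|: C' k' else A 0%N.
exists (W :|: \bigcup_(k < l) C' k), A'; split.
- by rewrite addnS ltnS.
- rewrite /= mulnS addnC; apply: leq_trans (leq_card_setU _ _) (leq_add Wh _).
  apply: leq_trans rho_ge; rewrite big_ord_recr /=; apply: leq_trans (leq_addr _ _).
  apply: (@leq_trans (\sum_(k < l) #|C' k|)).
    elim/big_rec2: _ => [|k c B _ IH]; first by rewrite cards0.
    exact: leq_trans (leq_card_setU _ _) (leq_add _ _).
  apply: leq_sum => k _; rewrite (HC _ (ltn_ord k)).2.
  exact: leq_trans (leq_div _ _) (stratum_mono _ (ltnW tT)).
- case=> [|k] kl /=; first by rewrite cA // /stratum !bin0.
  have [CN cC] := HC k kl; rewrite stratumS // -cA // -cC.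
  (* The sizes add up because newcomers lie outside [W] and [A k.+1] inside it. *)
  suff dAC : A k.+1 :&: C' k = finset.set0 by rewrite cardsU dAC cards0 subn0.
  apply/setP => u; rewrite !inE; apply/negP => /andP[uA uC].
  have := subsetP CN _ uC.
  by rewrite inE (subsetP (config_in_sub cfg kl) _ uA).
- have old k u : (k <= l)%N -> u \in A k -> exists v, [/\ timed_path (Y :: h) (u :: v),
      size v = (L * l + k)%N & {subset u :: v <= W :|: \bigcup_(k < l) C' k}].
    move=> kl /(pA _ _ kl)[v [tv sv vW]]; exists v; split=> //.
      exact: timed_path_mono.
    by move=> x /vW xW; rewrite inE xW.
  case=> [|k] u kl /=; first exact: old.
  rewrite inE => /orP[/old|uC]; first exact.
  have [CN _] := HC k kl; have := subsetP CN _ uC.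
  rewrite inE => /andP[uW /existsP[x /and3P[xA xuY xuh]]].
  have [v [tv sv vW]] := pA _ _ (ltnW kl) xA.
  exists (x :: v); split; last 2 first.
  + by rewrite /= sv addnS.
  + move=> y; rewrite inE => /predU1P[->|/vW yW]; last by rewrite inE yW.
    by rewrite inE; apply/orP; right; apply/bigcupP; exists (Ordinal kl).
  by apply: timed_path_extend => //; apply: contra uW => /vW.
Qed.

(** The top set has [M * 'C(T, l)] vertices, enough to choose a new bottom set of size [M * Q ^ l];
    the other sets restart empty because ['C(0, k) = 0] for positive [k]. *)
Lemma config_next L h : (Q ^ l <= 'C(T, l))%N -> config L T h -> config L.+1 0 h.
Proof.
move=> QT [W [A [Lh Wh cA pA]]].
have [B BA cB] : exists2 B : {set 'I_n}, B \subset A l & #|B| = stratum 0 0.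
  apply: exists_subset_card; rewrite cA // /stratum bin0 subnn subn0 expn0 !muln1.
  by rewrite leq_mul2l QT orbT.
exists W, (fun k => if k is 0%N then B else finset.set0); split=> //.
- by rewrite mulSn addn0 addnC.
- by case=> [|k] kl //; rewrite cards0 /stratum bin0n muln0.
- case=> [|k] u kl; last by rewrite inE.
  move=> /(subsetP BA) /(pA _ _ (leqnn l))[v [tv sv vW]]; exists v; split=> //.
  by rewrite sv mulSn addn0 addnC.
Qed.

Lemma config_nil : (stratum 0 0 <= n)%N -> config 0 0 [::].
Proof.
move=> sn; have [B _ cB] : exists2 B : {set 'I_n}, B \subset finset.setT & #|B| = stratum 0 0.
  by apply: exists_subset_card; rewrite cardsT card_ord.
exists B, (fun k => if k is 0%N then B else finset.set0); split=> //=.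
(* The successor in the bound [rho * (size h).+1] on [W] makes room for the starting vertices. *)
- by rewrite cB muln1; exact: stratum_le.
- by case=> [|k] kl //; rewrite cards0 /stratum bin0n muln0.
- case=> [|k] u kl; last by rewrite inE.
  by move=> uB; exists [::]; split=> // x; rewrite inE => /eqP ->.
Qed.

Lemma config_long_timed L t h : config L t h -> (0 < M)%N -> (0 < Q)%N ->
  long_timed (L * l) h.
Proof.
case=> W [A [_ _ cA pA]] M0 Q0.
have /card_gt0P[u uA] : (0 < #|A 0%N|)%N.
  by rewrite cA // /stratum bin0 muln1 muln_gt0 M0 expn_gt0 Q0.
have [v [tv sv _]] := pA _ _ (leq0n l) uA; apply/existsP.
have sz_v : size (u :: v) == (L * l).+1 by rewrite /= sv addn0.
by exists (Tuple sz_v).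
Qed.

End Configurations.

(** * Failure probability of a round and of a run of rounds *)

Section RoundFailure.
Variables (R : realType) (n : nat).
Implicit Types (p q : R) (E Y : {set {set 'I_n}}) (h : seq {set {set 'I_n}}).

Lemma exists_le_sum (I : finType) (P : pred I) :
  ([exists i, P i])%:R <= \sum_i (P i)%:R :> R.
Proof.
case: existsP => [[i Pi]|_]; last by apply: sumr_ge0.
by rewrite (bigD1 i) //= Pi lerDl sumr_ge0.
Qed.

(** Union bound over [w] and two distinct vertices of [A]: as [w] lies outside [W], the two pairs
    are distinct and both drawn with probability [q ^+ 2]. *)
Lemma mean_collision q (W A : {set 'I_n}) : 0 <= q <= 1 -> A \subset W ->
  mean q (fun Y => (collision Y W A)%:R) <= n%:R * #|A|%:R ^+ 2 * q ^+ 2.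
Proof.
move=> q01 AW.
apply: (@le_trans _ _ (mean q (fun Y => \sum_w \sum_u \sum_u'
    ([&& w \notin W, u \in A, u' \in A, u != u',
      [set u; w]%SET \in Y & [set u'; w]%SET \in Y])%:R))).
  apply: le_mean => // Y _; apply: le_trans (exists_le_sum _) (ler_sum _ _) => w _.
  by apply: le_trans (exists_le_sum _) (ler_sum _ _) => u _; exact: exists_le_sum.
rewrite mean_sum; apply: (@le_trans _ _ (\sum_(w < n) #|A|%:R ^+ 2 * q ^+ 2)); last first.
  by rewrite sumr_const card_ord -mulrA mulr_natl.
apply: ler_sum => w _; rewrite mean_sum.
have cA : #|A|%:R = \sum_u (u \in A)%:R :> R.
  by rewrite -sum1_card natr_sum big_mkcond; apply: eq_bigr => u _; case: (u \in A).
rewrite cA expr2 !mulr_suml; apply: ler_sum => u _.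
rewrite mean_sum mulr_sumr mulr_suml; apply: ler_sum => u' _.
have [wW|wW] := boolP (w \in W).
  by rewrite /= mean_cst -natrM mulr_ge0 ?sqr_ge0.
have [uA|uA] /= := boolP (u \in A); last by rewrite mean_cst !mul0r.
have [u'A|u'A] /= := boolP (u' \in A); last by rewrite mean_cst mulr0 mul0r.
rewrite !mul1r.
have [uu'|uu'] /= := eqVneq u u'; first by rewrite mean_cst sqr_ge0.
have pair_uw x : x \in A -> [set x; w]%SET \in pairs n.
  by move=> xA; rewrite inE cards2 (contraNneq _ wW) // => <-; exact: (subsetP AW).
rewrite mean_in2 ?pair_uw //; apply: contraNneq uu' => /setP /(_ u).
rewrite !inE eqxx /= => /esym/orP[//|/eqP uw].
by move: wW; rewrite -uw (subsetP AW).
Qed.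

Definition dead d h := [exists u, (d < dead_degree h u)%N].

Lemma dead_mono d Y h : dead d h -> dead d (Y :: h).
Proof.
case/existsP=> u du; apply/existsP; exists u; apply: leq_trans du _.
by apply: subset_leq_card; apply/subsetP => w; rewrite !inE cov_cons inE orbC => ->.
Qed.

(** The rounds unite to $G_{n,p}$, so Chebyshev applies to the degree of each vertex, followed by a
    union bound over the vertices. *)
Lemma dead_prob q N (d : nat) (p := 1 - (1 - q) ^+ N) : 0 <= q <= 1 ->
    p * n%:R < d%:R ->
  expect q N [::] (fun h => (dead d h)%:R)
    <= n%:R * (p * n%:R / (d%:R - p * n%:R) ^+ 2).
Proof.
move=> q01 pd; have p01 : 0 <= p <= 1.
  case/andP: q01 => q0 q1; rewrite /p gerBl subr_ge0 exprn_ge0 ?exprn_ile1 ?subr_ge0 //.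
  by rewrite gerBl.
have [p0 _] := andP p01.
rewrite (expect_cov q N [::] (fun E =>
   ([exists u, (d < #|[set w | [set u; w]%SET \in E]%SET|)%N])%:R)) -/p.
apply: le_trans (le_mean p01 (fun E _ => exists_le_sum _)) _.
have -> : n%:R * (p * n%:R / (d%:R - p * n%:R) ^+ 2) =
    \sum_(u < n) (p * n%:R / (d%:R - p * n%:R) ^+ 2).
  by rewrite sumr_const card_ord mulr_natl.
rewrite mean_sum; apply: ler_sum => u _.
pose D : {set {set 'I_n}} := [set [set u; w]%SET | w in [set~ u]]%SET.
have D_pairs : D \subset pairs n.
  apply/subsetP => _ /imsetP[w + ->]; rewrite !inE => wu.
  by rewrite cards2 (eq_sym u) wu.
have D_le : p * #|D|%:R <= p * n%:R.
  rewrite ler_wpM2l // ler_nat -[leqRHS](card_ord n).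
  exact: leq_trans (leq_imset_card _ _) (max_card _).
apply: (@le_trans _ _ (mean p (fun E => (d <= #|E :&: D|)%N%:R))).
  apply: le_mean => // E sE; rewrite cov_nil setU0 ler_nat.
  have [|//] := ltnP d _ => dE; rewrite (leq_trans (ltnW dE)) //.
  (* Edges are genuine pairs, so [w = u] is excluded and an edge at [u] determines its other end. *)
  rewrite -(card_in_imset (f := fun w => [set u; w]%SET)).
    apply: subset_leq_card; apply/subsetP => _ /imsetP[w + ->].
    rewrite inE => uwE; rewrite inE uwE; apply: imset_f; rewrite !inE.
    have := subsetP sE _ uwE; rewrite inE cards2.
    by rewrite (eq_sym w); case: (u == w).
  move=> w w'; rewrite !inE => /(subsetP sE) + /(subsetP sE).
  rewrite !inE !cards2; case: (eqVneq u w) => // uw _; case: (eqVneq u w') => // _ _.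
  by move/setP/(_ w); rewrite !inE eqxx orbT eq_sym (negbTE uw) /= => /esym/eqP.
apply: le_trans (card_upper_tail p01 D_pairs (le_lt_trans D_le pd)) _.
apply: ler_pM => //; first by rewrite mulr_ge0.
- by rewrite invr_ge0 sqr_ge0.
- rewrite lef_pV2 ?posrE ?exprn_gt0 ?subr_gt0 ?(le_lt_trans D_le) //.
  by rewrite ler_sqr ?nnegrE; lra.
Qed.

Variables (l Q T M rho N d : nat) (q eta : R).
Hypothesis q01 : 0 < q <= 1.
Hypothesis eta_gt0 : 0 < eta <= 1.
Hypothesis Q_gt0 : (0 < Q)%N.
Hypothesis M_gt0 : (0 < M)%N.
Hypothesis rho_ge : (\sum_(k < l.+1) stratum l Q M T k <= rho)%N.
(** With at most [rho * N] vertices used and [d] dead pairs per vertex, the expected number of fresh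
    pairs drawn at a set [A], reduced by the factor [1 - eta], still reaches |A| / Q. *)
Hypothesis rate : 1 <= (1 - eta) * q * Q%:R * (n%:R - (rho * N + d)%:R).

Notation config := (@config n l Q T M rho).

(** For each of the [l] strata, one term for too few drawn pairs and one for collisions. *)
Definition failure_rate : R :=
  l%:R * ((eta ^+ 2 * M%:R)^-1 + n%:R * rho%:R ^+ 2 * q ^+ 2).

Let q01' : 0 <= q <= 1. Proof. by case/andP: q01 => /ltW -> ->. Qed.

Lemma failure_rate_ge0 : 0 <= failure_rate.
Proof.
apply: mulr_ge0 => //; apply: addr_ge0.
  by rewrite invr_ge0; apply: mulr_ge0 => //; exact: sqr_ge0.
apply: mulr_ge0; last exact: sqr_ge0.
by apply: mulr_ge0 => //; exact: sqr_ge0.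
Qed.

(** The target [c] is a multiple of [M]. If it is 0 nothing can fail; otherwise [rate] puts it at
    most [1 - eta] times the mean, so the mean is at least [M] and Chebyshev applies. *)
Lemma few_newcomers_prob W A L t h k : config_in l Q T M rho W A L t h ->
    ~~ dead d h -> (t < T)%N -> (size h < N)%N -> (k < l)%N ->
  mean q (fun Y => (#|Y :&: fresh_pairs h W (A k)| < stratum l Q M t k %/ Q)%N%:R)
    <= (eta ^+ 2 * M%:R)^-1.
Proof.
move=> cfg nd tT hN kl; have [_ Wh cA _] := cfg.
have AW := config_in_sub cfg (ltnW kl).
have eta0 : 0 < eta by case/andP: eta_gt0.
set c := (_ %/ Q)%N; have [-> |c_gt0] := posnP c.
  by rewrite mean_cst invr_ge0; apply: mulr_ge0 => //; exact: sqr_ge0.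
have cQ : (c * Q)%N = #|A k|.
  by rewrite cA ?(ltnW kl) // /c stratum_div // /stratum -(subnSK kl) expnSr !mulnA.
have Mc : (M <= c)%N.
  move: c_gt0; rewrite /c stratum_div // !muln_gt0 -mulnA => /andP[/andP[_ C0] Q0].
  by rewrite leq_pmulr // muln_gt0 C0.
set D := fresh_pairs h W (A k).
have AD : #|A k|%:R * (n%:R - (rho * N + d)%:R) <= #|D|%:R :> R.
  apply: le_trans (_ : (#|A k| * (n - (#|W| + d)))%N%:R <= _); last first.
    rewrite ler_nat; apply: card_fresh_pairs => // u; rewrite leqNgt.
    by move: nd => /existsPn /(_ u).
  rewrite natrM ler_wpM2l //; apply: le_trans (_ : n%:R - (#|W| + d)%:R <= _).
    rewrite lerD2l lerN2 ler_nat leq_add2r (leq_trans Wh) // leq_mul2l hN orbT //.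
  by rewrite lerBlDr -natrD ler_nat addnC -leq_subLR.
have cqD : c%:R <= (1 - eta) * (q * #|D|%:R).
  apply: (@le_trans _ _ ((1 - eta) * (q * (#|A k|%:R * (n%:R - (rho * N + d)%:R))))).
    rewrite -cQ natrM -[leLHS]mulr1.
    rewrite [leRHS](_ : _ = c%:R * ((1 - eta) * q * Q%:R * (n%:R - (rho * N + d)%:R))); last by ring.
    by rewrite ler_wpM2l.
  rewrite ler_wpM2l ?subr_ge0 //; first by case/andP: eta_gt0.
  by rewrite ler_wpM2l //; case/andP: q01'.
have D_ge : M%:R <= q * #|D|%:R.
  apply: (@le_trans _ _ c%:R); first by rewrite ler_nat.
  apply: le_trans cqD _; rewrite ler_piMl ?mulr_ge0 //; first by case/andP: q01'.
  by rewrite gerBl ltW.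
have M_gt0' : 0 < M%:R :> R by rewrite ltr0n.
have D_gt0 : (0 < #|D|)%N.
  rewrite lt0n; apply/negP => /eqP D0; move: D_ge; rewrite D0 mulr0.
  by rewrite leNgt M_gt0'.
apply: le_trans (card_lower_tail q01 (fresh_pairs_sub _ AW) eta0 D_gt0 cqD) _.
have e2 : 0 < eta ^+ 2 by rewrite exprn_gt0.
rewrite lef_pV2 ?posrE; [by rewrite ler_pM2l | 
  by rewrite mulr_gt0 // (lt_le_trans M_gt0') | by rewrite mulr_gt0].
Qed.

Lemma config_step_prob L t h : config L t h -> ~~ dead d h ->
    (t < T)%N -> (size h < N)%N ->
  mean q (fun Y => (`[< ~ config L t.+1 (Y :: h) >])%:R) <= failure_rate.
Proof.
move=> [W [A cfg]] nd tT hN.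
apply: (@le_trans _ _ (mean q (fun Y => \sum_(k < l)
   ((#|Y :&: fresh_pairs h W (A k)| < stratum l Q M t k %/ Q)%N%:R
     + (collision Y W (A k))%:R)))).
  apply: le_mean => // Y _; case: asboolP => [Nc|_]; last first.
    by apply: sumr_ge0 => k _; rewrite addr_ge0.
  have [/existsP[k bad]|/existsPn ok] := boolP [exists k : 'I_l,
    (#|Y :&: fresh_pairs h W (A k)| < stratum l Q M t k %/ Q)%N || collision Y W (A k)].
    rewrite (bigD1 k) //= -[leLHS]addr0 lerD //; last first.
      by apply: sumr_ge0 => k' _; rewrite addr_ge0.
    by rewrite -natrD ler_nat; case/orP: bad => ->; rewrite ?addn1.
  case: Nc; apply: config_step cfg _ _ _ => // k kl;
    by have := ok (Ordinal kl); rewrite negb_or -leqNgt => /andP[].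
have -> : failure_rate = \sum_(k < l)
    ((eta ^+ 2 * M%:R)^-1 + n%:R * rho%:R ^+ 2 * q ^+ 2).
  by rewrite sumr_const card_ord /failure_rate mulr_natl.
rewrite mean_sum.
apply: ler_sum => k _; rewrite meanD lerD //; first exact: (few_newcomers_prob cfg nd tT hN (ltn_ord k)).
have AW := config_in_sub cfg (ltnW (ltn_ord k)).
apply: le_trans (mean_collision q01' AW) _.
rewrite ler_wpM2r ?sqr_ge0 // ler_wpM2l // ler_sqr ?nnegrE // ler_nat.
by case: cfg => _ _ cA _; rewrite cA ?(stratum_le rho_ge) // ltnW.
Qed.

Lemma expect_dead j h : dead d h -> expect q j h (fun h' => (dead d h')%:R) = 1.
Proof.
move=> dh; rewrite -[RHS](expect_cst q j h); apply/eqP; rewrite eq_le.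
apply/andP; split; first by apply: le_expect => // h'; case: dead.
apply: (@le_expect_inv _ _ (fun _ h' => dead d h')) => //; last by move=> h' ->.
by move=> _ h' Y dh' _; exact: dead_mono.
Qed.

(** Each round costs one [failure_rate] as long as the history is not dead, and a dead history stays
    dead. *)
Lemma config_run_prob L t j h : config L t h -> (t + j <= T)%N -> (size h + j <= N)%N ->
  1 - j%:R * failure_rate <=
    expect q j h (fun h' => (dead d h' || `[< config L (t + j) h' >])%:R).
Proof.
have f0 := failure_rate_ge0.
elim: j t h => [|j IH] t h cfg tT hN.
  by rewrite /= addn0 mul0r subr0; case: asboolP => //; rewrite orbT.
have [dh|dh] := boolP (dead d h).
  apply: (@le_trans _ _ (expect q j.+1 h (fun h' => (dead d h')%:R))).
    by rewrite expect_dead // gerBl mulr_ge0.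
  apply: le_expect => // h'.
  by rewrite ler_nat; case: (dead d h').
(* A failed first round is charged a full 1, which makes the integrand nonpositive; otherwise
   induction applies to the remaining [j] rounds. *)
apply: (@le_trans _ _ (mean q (fun Y => (1 - j%:R * failure_rate) +
    (-1) * (`[< ~ config L t.+1 (Y :: h) >])%:R))).
  rewrite meanD mean_cst meanZ mulN1r -[j.+1]addn1 natrD mulrDl mul1r opprD addrA lerD2l lerN2.
  by apply: config_step_prob => //; [apply: leq_trans tT; rewrite addnS ltnS leq_addr
    | apply: leq_trans hN; rewrite addnS ltnS leq_addr].
rewrite /=; apply: le_mean => // Y _; case: asboolP => [_|/contrapT cfg'].
  rewrite mulr1 addrAC subrr add0r; apply: (@le_trans _ _ 0).
    by rewrite oppr_le0 mulr_ge0.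
  by rewrite -[leLHS](expect_cst q j (Y :: h)); apply: le_expect.
rewrite mulr0 addr0 addnS -addSn; apply: IH => //=; first by rewrite addSnnS.
by rewrite addSnnS.
Qed.

End RoundFailure.

(** * A lower bound for fixed parameters, by a potential argument *)

Section FiniteBound.
Variables (R : realType) (n : nat).
Implicit Types (Y : {set {set 'I_n}}) (h : seq {set {set 'I_n}}).

Lemma timed_path_behead h (u : 'I_n) v : timed_path h (u :: v) -> timed_path h v.
Proof.
case: v => [|w v] //; rewrite /timed_path path_edges_cons2.
case/and3P => /= /andP[_ uv] /andP[_ av] sv; rewrite uv av.
exact: path_sorted sv.
Qed.

Lemma long_timed_le c c' h : (c <= c')%N -> long_timed c' h -> long_timed c h.
Proof.
move=> /subnKC <-; elim: (c' - c)%N => [|k IH]; first by rewrite addn0.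
rewrite addnS => /existsP[[[|u v] //= sz_v] tv]; apply: IH.
by apply/existsP; exists (Tuple (sz_v : size v == (c + k).+1)); exact: timed_path_behead tv.
Qed.

Variables (l Q T M rho m d : nat) (q eta : R).
Let N := (m * T)%N.
Hypothesis q01 : 0 < q <= 1.
Hypothesis eta_gt0 : 0 < eta <= 1.
Hypothesis Q_gt0 : (0 < Q)%N.
Hypothesis M_gt0 : (0 < M)%N.
Hypothesis T_gt0 : (0 < T)%N.
Hypothesis rho_ge : (\sum_(k < l.+1) stratum l Q M T k <= rho)%N.
Hypothesis rate : 1 <= (1 - eta) * q * Q%:R * (n%:R - (rho * N + d)%:R).
Hypothesis bin_ge : (Q ^ l <= 'C(T, l))%N.

Notation config := (@config n l Q T M rho).
Notation delta := (failure_rate n l M rho q eta).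

Let q01' : 0 <= q <= 1. Proof. by case/andP: q01 => /ltW -> ->. Qed.

(** The number of completed blocks; the range of [L] suffices because [config L t h] forces
    [L * T <= size h]. *)
Definition level h : nat := (\max_(L < (size h).+1 | `[< config L 0 h >]) L)%N.

Lemma config_level_le L t h : config L t h -> (L * T <= size h)%N.
Proof. by case=> W [A [Lh _ _ _]]; apply: leq_trans Lh; exact: leq_addr. Qed.

Lemma level_ge L h : config L 0 h -> (L <= level h)%N.
Proof.
move=> cfg; have Lh : (L < (size h).+1)%N.
  by rewrite ltnS (leq_trans _ (config_level_le cfg)) // leq_pmulr.
apply: (@leq_bigmax_cond _ (fun L : 'I_(size h).+1 => `[< config L 0 h >])
  (fun L => L : nat) (Ordinal Lh)).
exact/asboolP.
Qed.

Lemma config_level h : config 0 0 h -> config (level h) 0 h.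
Proof.
move=> cfg; pose C := [pred L : 'I_(size h).+1 | `[< config L 0 h >]].
have C0 : (0 < #|C|)%N.
  by apply/card_gt0P; exists ord0; rewrite inE; apply/asboolP.
have [L /asboolP cL eL] := eq_bigmax_cond (fun L : 'I_(size h).+1 => L : nat) C0.
by have -> : level h = L by rewrite -eL.
Qed.

(* The second term lets the potential grow surely on the rare histories where
   too many pairs at some vertex are already spent. *)
Definition potential h : R := (level h)%:R + (dead d h)%:R * (size h)%:R.

(** The level never drops. It rises when the block succeeds; if the history is or becomes dead, the
    second term alone grows by at least [T], hence by at least 1. *)
Lemma potential_block h : config 0 0 h -> (size h + T <= N)%N ->
  potential h + (1 - T%:R * delta) <= expect q T h potential.
Proof.
move=> cfg0 hN; have cfg := config_level cfg0.
have d0 := failure_rate_ge0 n l M rho q eta.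
pose I j h' := [/\ config (level h) 0 h', (size h' + j = size h + T)%N & dead d h -> dead d h'].
have I0 : I T h by [].
have IS j h' Y : I j.+1 h' -> Y \subset pairs n -> I j (Y :: h').
  case=> c s dh _; split; [exact: config_mono | by rewrite /= addSnnS |].
  by move=> /dh; exact: dead_mono.
have T1 : 1 <= T%:R :> R by rewrite ler1n.
have [dh|dh] := boolP (dead d h).
  apply: (@le_trans _ _ (potential h + T%:R)).
    rewrite lerD2l; apply: le_trans T1; rewrite gerBl mulr_ge0 //.
  rewrite -[leLHS](expect_cst q T h); apply: (le_expect_inv q01' I0 IS) => h' [c s dh'].
  rewrite /potential dh dh' // !mul1r -addrA; apply: lerD.
    by rewrite ler_nat level_ge.
  by rewrite -natrD -s addn0.
rewrite /potential (negbTE dh) mul0r addr0.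
have run := config_run_prob q01 eta_gt0 Q_gt0 M_gt0 rho_ge rate cfg (leqnn T) hN.
apply: le_trans (lerD (lexx _) run) _.
rewrite -[X in X + _](expect_cst q T h) -expectD.
apply: (le_expect_inv q01' I0 IS) => h' [c s _].
have lh : (level h)%:R <= (level h')%:R :> R by rewrite ler_nat level_ge.
case: (boolP (dead d h')) => [_|_] /=.
  rewrite mul1r lerD // (le_trans T1) // ler_nat.
  by rewrite -(leq_add2l (size h)) -s addn0 leq_addl.
rewrite mul0r addr0; case: asboolP => [|_]; last by rewrite addr0.
by move/(config_next bin_ge)/level_ge; rewrite natr1 ler_nat.
Qed.

Lemma potential_blocks k h : config 0 0 h -> (size h + k * T <= N)%N ->
  potential h + k%:R * (1 - T%:R * delta) <= expect q (k * T) h potential.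
Proof.
elim: k h => [|k IH] h cfg; first by rewrite mul0r addr0.
rewrite mulSn => hN; rewrite expect_add.
apply: (@le_trans _ _ (expect q T h (fun h' => potential h' + k%:R * (1 - T%:R * delta)))).
  rewrite expectD expect_cst -[k.+1]addn1 natrD mulrDl mul1r [k%:R * _ + _]addrC addrA.
  rewrite lerD2r potential_block //; apply: leq_trans hN.
  by rewrite addnA leq_addr.
apply: (@le_expect_inv _ _ (fun j h' => config 0 0 h' /\ (size h' + j = size h + T)%N)) => //.
- by move=> j h' Y [c s] _; split; [exact: config_mono | rewrite /= addSnnS].
- move=> h' [c]; rewrite addn0 => s; apply: IH => //.
  by rewrite s -addnA.
Qed.

(** Markov's inequality for the shortfall [m - level h]: it is nonnegative, has small mean by
    [potential_blocks], and is at least [beta * m] if [L0] is missed. *)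
Lemma expect_long_timed (beta : R) (L0 : nat) : (stratum l Q M 0 0 <= n)%N ->
    (0 < m)%N -> 0 < beta -> L0%:R <= (1 - beta) * m%:R ->
  1 - (T%:R * delta + T%:R * expect q N [::] (fun h => (dead d h)%:R)) / beta
  <= expect q N [::] (fun h => (long_timed (L0 * l) h)%:R).
Proof.
move=> sn m0 b0 L0m; set P := expect _ _ _ _.
have m_gt0 : 0 < m%:R :> R by rewrite ltr0n.
have cfg0 := config_nil rho_ge sn.
have blocks := potential_blocks cfg0 (leqnn (m * T)%N).
have pot0 : 0 <= potential [::] by rewrite addr_ge0 // mulr_ge0.
(* After [N] rounds the dead terms cancel, and the right-hand integrand is the shortfall. *)
have key : expect q N [::] (fun h => beta * m%:R *
     (1 + (-1) * (long_timed (L0 * l) h)%:R)) <=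
   expect q N [::] (fun h => (m%:R + N%:R * (dead d h)%:R) + (-1) * potential h).
  apply: (@le_expect_inv _ _ (fun j h' => config 0 0 h' /\ (size h' + j = N)%N)) => //.
    by move=> j h' Y [c s] _; split; [exact: config_mono | rewrite /= addSnnS].
  move=> h [c]; rewrite addn0 => s; have cl := config_level c.
  have lm : (level h)%:R <= m%:R :> R.
    by rewrite ler_nat -(leq_pmul2r T_gt0) (leq_trans (config_level_le cl)) // s.
  rewrite /potential s (mulrC _ N%:R).
  case: (boolP (long_timed _ _)) => [_|nlt].
    rewrite mulr1 subrr mulr0; move: lm; set a := level h; set b := _ * _; lra.
  have : (level h < L0)%N.
    rewrite ltnNge; apply: contra nlt => L0h.
    by apply: long_timed_le (config_long_timed cl M_gt0 Q_gt0); rewrite leq_mul2r L0h orbT.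
  rewrite -(ltr_nat R) => lev.
  rewrite mulr0 addr0 mulr1; set b := N%:R * _; lra.
move: key; rewrite !(expectZ, expectD) !expect_cst -/P => key.
set X := expect q N [::] (fun h => (long_timed (L0 * l) h)%:R).
rewrite -/X in key.
have : m%:R * (beta * (1 - X)) <= m%:R * (T%:R * delta + T%:R * P).
  move: key blocks pot0; rewrite /N natrM.
  set V := expect q _ _ potential; set V0 := potential _.
  move=> key blocks V00; rewrite -expectD -/V in key; lra.
rewrite ler_pM2l // -ler_pdivlMl // mulrC => bX; lra.
Qed.

Lemma ordered_Gnp_lower (beta : R) (L0 : nat) (p := 1 - (1 - q) ^+ N) :
    (stratum l Q M 0 0 <= n)%N -> (0 < m)%N -> 0 < beta ->
    L0%:R <= (1 - beta) * m%:R -> p * n%:R < d%:R ->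
  1 - T%:R / beta * (delta + n%:R * (p * n%:R / (d%:R - p * n%:R) ^+ 2))
  <= ordered_Gnp_prob p (fun (E : {set {set 'I_n}}) (f : labelling E) =>
       (L0 * l <= longest_increasing_path f)%N).
Proof.
move=> sn m0 b0 L0m pd.
apply: le_trans (Gnp_prob_long_timed n N (L0 * l) q01').
apply: le_trans (expect_long_timed sn m0 b0 L0m).
rewrite lerD2l lerN2 -mulrDr mulrAC; apply: ler_wpM2l; first by rewrite divr_ge0 // ltW.
by rewrite lerD2l; exact: dead_prob.
Qed.

End FiniteBound.

(** * Choice of [l], [Q], [T], where the constant $e$ arises *)

Section GrowthConstants.
Variable R : realType.

Lemma bernoulli (s : R) l : 0 <= s -> 1 + l%:R * s <= (1 + s) ^+ l.
Proof.
move=> s0; elim: l => [|l IH]; first by rewrite mul0r addr0 expr0.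
rewrite exprS; apply: le_trans (ler_wpM2l _ IH); last by rewrite addr_ge0.
have : 0 <= l%:R * s ^+ 2 by rewrite mulr_ge0 // sqr_ge0.
by rewrite -[l.+1]addn1 natrD; set x := l%:R; move=> H; nra.
Qed.

(** Raise $1 - x \le e^{-x}$ at $x = 1/(l+1)$ to the power $l+1$. *)
Lemma expR1_le_succ_ratio l :
  expR 1 * l%:R ^+ l.+1 <= l.+1%:R ^+ l.+1 :> R.
Proof.
have l0 : 0 < l.+1%:R :> R by rewrite ltr0n.
have := expR_ge1Dx (- l.+1%:R^-1 : R).
have -> : 1 + - l.+1%:R^-1 = l%:R / l.+1%:R :> R.
  by rewrite -[l%:R](addrK 1) natr1 mulrBl divff ?gt_eqF // mul1r.
have r0 : 0 <= l%:R / l.+1%:R :> R by rewrite divr_ge0.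
rewrite -(ler_pXn2r (ltn0Sn l)) ?nnegrE ?expR_ge0 // -expRM_natl mulrN divff ?gt_eqF //.
rewrite expRN expr_div_n ler_pdivrMr ?exprn_gt0 // => H.
by rewrite -ler_pdivlMl ?expR_gt0.
Qed.

(** A weak Stirling bound, $l! \le e\,l\,(l/e)^l$, by induction from [expR1_le_succ_ratio]. *)
Lemma factorial_le l : (0 < l)%N ->
  (l`!)%:R * expR 1 ^+ l <= expR 1 * l%:R ^+ l.+1 :> R.
Proof.
case: l => // l _; elim: l => [|l IH]; first by rewrite factS fact0 muln1 expr1 expr1n mul1r mulr1.
rewrite factS natrM exprS.
apply: (@le_trans _ _ (l.+2%:R * expR 1 * (expR 1 * l.+1%:R ^+ l.+2))).
  rewrite [leLHS](_ : _ = l.+2%:R * expR 1 * ((l.+1)`!%:R * expR 1 ^+ l.+1)); last by ring.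
  by rewrite ler_wpM2l // mulr_ge0 // expR_ge0.
rewrite [leRHS](_ : _ = l.+2%:R * expR 1 * l.+2%:R ^+ l.+2); last first.
  by rewrite [l.+2%:R ^+ l.+3]exprS; ring.
by rewrite ler_wpM2l ?expR1_le_succ_ratio // mulr_ge0 // expR_ge0.
Qed.

(** By [factorial_le] it suffices that $e\,l\,r^l \le 1$ for $r = b/e < 1$, which holds for large
    $l$. *)
Lemma exists_factorial_lt (b : R) : 0 < b -> b < expR 1 ->
  exists2 l, (0 < l)%N & b ^+ l * (l`!)%:R <= l%:R ^+ l.
Proof.
move=> b0 be; have e0 : 0 < expR 1 :> R by exact: expR_gt0.
(* As [r <= t ^+ 2], Bernoulli's bound on [t ^+ l] is squared to give decay of order $1/l^2$, which
   beats the factor $l$. *)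
pose r := b / expR 1; pose t := (1 + r) / 2; pose s := t^-1 - 1.
have r0 : 0 < r by rewrite divr_gt0.
have r1 : r < 1 by rewrite ltr_pdivrMr // mul1r.
have t0 : 0 < t by rewrite /t; lra.
have t1 : t < 1 by rewrite /t; lra.
have rt : r <= t ^+ 2 by have := sqr_ge0 (1 - r); rewrite /t; nra.
have s0 : 0 < s by rewrite subr_gt0 invf_gt1.
have tE : t = (1 + s)^-1 by rewrite /s addrC subrK invrK.
have [l l_gt0 ls] : exists2 l, (0 < l)%N & expR 1 <= l%:R * s ^+ 2.
  exists (Num.truncn (expR 1 / s ^+ 2)).+1 => //.
  by rewrite -ler_pdivrMr ?exprn_gt0 // ltW // truncnS_gt.
have l0 : 0 < l%:R :> R by rewrite ltr0n.
exists l => //.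
have s1 : 0 < 1 + s by lra.
have ls0 : 0 < l%:R * s by rewrite mulr_gt0.
have tl : t ^+ l <= (l%:R * s)^-1.
  rewrite tE exprVn lef_pV2 ?posrE ?exprn_gt0 //.
  by apply: le_trans (bernoulli l (ltW s0)); rewrite lerDr.
have rl : r ^+ l <= (l%:R * s)^-1 ^+ 2.
  apply: (@le_trans _ _ ((t ^+ 2) ^+ l)).
    by rewrite lerXn2r // nnegrE ?sqr_ge0 // ltW.
  rewrite exprAC ler_sqr ?nnegrE //; first by rewrite exprn_ge0 // ltW.
  by rewrite invr_ge0 ltW.
have bE : b = r * expR 1 by rewrite divfK ?gt_eqF.
rewrite bE exprMn -mulrA [expR 1 ^+ l * _]mulrC.
apply: le_trans (ler_wpM2l _ (factorial_le l_gt0)) _; first by rewrite exprn_ge0 // ltW.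
apply: le_trans (ler_wpM2r _ rl) _.
  by rewrite mulr_ge0 ?exprn_ge0 // ltW.
rewrite [l%:R ^+ l.+1]exprS [leLHS](_ : _ = expR 1 / (l%:R * s ^+ 2) * l%:R ^+ l); last first.
  by field; rewrite !gt_eqF.
by rewrite ler_piMl ?exprn_ge0 // ler_pdivrMr ?mul1r // mulr_gt0 // exprn_gt0.
Qed.

Lemma expn_le_ffact T k j : (j <= k)%N -> ((T - k) ^ j <= T ^_ j)%N.
Proof.
elim: j => // j IH jk; rewrite ffactnSr expnSr leq_mul ?IH ?(ltnW jk) //.
by rewrite leq_sub2l // ltnW.
Qed.

(** With $T = ls$, $\binom{T}{l}\,l! \ge (l(s-1))^l \ge (b(s-1))^l\,l!$ for some $b$ between $a$ and
    $e$. *)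
Lemma exists_growth_constants (a : R) : 0 < a -> a < expR 1 ->
  exists l Q T, [/\ (0 < l)%N, (0 < Q)%N, (0 < T)%N, (Q ^ l <= 'C(T, l))%N
    & a * T%:R <= l%:R * Q%:R].
Proof.
move=> a0 ae; pose b := (a + expR 1) / 2.
have ab : a < b by rewrite /b; lra.
have be : b < expR 1 by rewrite /b; lra.
have [l l0 bl] := exists_factorial_lt (lt_trans a0 ab) be.
(* Chosen so that an integer [Q] fits between [a * s] and [b * (s - 1)]. *)
pose s := (Num.truncn ((b + 1) / (b - a))).+1.
have sb : b + 1 <= s%:R * (b - a).
  by rewrite -ler_pdivrMr ?subr_gt0 // ltW // truncnS_gt.
pose Q := (Num.truncn (a * s%:R)).+1.
have as0 : 0 <= a * s%:R by rewrite mulr_ge0 // ltW.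
have Q1 : a * s%:R <= Q%:R by rewrite ltW // truncnS_gt.
have Q2 : Q%:R <= b * (s - 1)%N%:R.
  rewrite -[Q]addn1 natrD natrB // mulrBr mulr1.
  have := truncn_le (a * s%:R); rewrite as0.
  move: sb; set x := s%:R; set y := (_)%:R; move=> *; lra.
exists l, Q, (l * s)%N; split=> //.
- by rewrite muln_gt0 l0.
- rewrite -(leq_pmul2r (fact_gt0 l)) bin_ffact.
  apply: leq_trans (expn_le_ffact (l * s) (leqnn l)).
  have -> : (l * s - l = l * (s - 1))%N by rewrite mulnBr muln1.
  rewrite -(ler_nat R) natrM expnMn natrM !natrX.
  apply: (@le_trans _ _ ((b * (s - 1)%N%:R) ^+ l * (l`!)%:R)).
    by rewrite ler_wpM2r // ler_pXn2r ?nnegrE // (le_trans _ Q2).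
  by rewrite exprMn mulrAC ler_wpM2r // exprn_ge0.
- by rewrite natrM mulrCA ler_wpM2l.
Qed.

End GrowthConstants.

(** * Choice of the remaining parameters and numerical estimates *)

Section LargeProbability.
Variable R : realType.

Lemma bernoulli_sub (q : R) N : 0 <= q <= 1 -> 1 - N%:R * q <= (1 - q) ^+ N.
Proof.
case/andP=> q0 q1; elim: N => [|N IH]; first by rewrite mul0r subr0 expr0.
rewrite exprS; apply: le_trans (ler_wpM2l _ IH); last by rewrite subr_ge0.
have : 0 <= N%:R * q ^+ 2 by rewrite mulr_ge0 // sqr_ge0.
by rewrite -[N.+1]addn1 natrD; set x := N%:R; move=> H; nra.
Qed.

(** Take $q = 1 - (1-p)^{1/N}$. The lower bound is Bernoulli's; the upper one follows from
    $(1-p)(1+Nq) \le (1-q)^N(1+q)^N \le 1$. *)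
Lemma exists_round_prob (p : R) N : 0 < p -> p <= 1 / 2 -> (0 < N)%N ->
  exists q : R, [/\ 0 < q <= 1, 1 - (1 - q) ^+ N = p, p <= N%:R * q
    & N%:R * q <= 2 * p].
Proof.
move=> p0 p1 N0; have N_gt0 : 0 < N%:R :> R by rewrite ltr0n.
have p1' : 0 < 1 - p by lra.
pose x := expR (ln (1 - p) / N%:R).
have x0 : 0 < x by exact: expR_gt0.
have x1 : x < 1.
  by rewrite -expR0 ltr_expR pmulr_llt0 ?invr_gt0 // ln_lt0 //; lra.
have xN : x ^+ N = 1 - p.
  by rewrite /x -expRM_natl mulrC divfK ?gt_eqF // lnK.
exists (1 - x); have q01 : 0 <= 1 - x <= 1 by lra.
split; first by lra.
- by rewrite subKr xN subKr.
- by have := bernoulli_sub N q01; rewrite subKr xN; lra.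
have q0 : 0 <= 1 - x by lra.
have b := bernoulli N q0.
have : x ^+ N * (1 + (1 - x)) ^+ N <= 1.
  rewrite -exprMn exprn_ile1 //; first by rewrite mulr_ge0 //; lra.
  by have := sqr_ge0 (1 - x); nra.
rewrite xN => xb; have : (1 - p) * (1 + N%:R * (1 - x)) <= 1.
  by apply: le_trans xb; rewrite ler_wpM2l // ltW.
have : 0 <= N%:R * (1 - x) by rewrite mulr_ge0.
set y := N%:R * _ => y0 H; nra.
Qed.

Lemma ordered_Gnp_prob_mono n (p : R) (A B : forall E : {set {set 'I_n}}, pred (labelling E)) :
  0 <= p <= 1 -> (forall E f, A E f -> B E f) ->
  ordered_Gnp_prob p A <= ordered_Gnp_prob p B.
Proof.
move=> p01 AB; apply: ler_sum => E _; rewrite ler_wpM2l ?Gnp_weight_ge0 //.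
rewrite /ordering_prob ler_wpM2r ?invr_ge0 // ler_nat; apply: subset_leq_card.
by apply/subsetP => f; rewrite !inE => /andP[-> /AB].
Qed.

Lemma ordered_Gnp_prob_le1 n (p : R) (A : forall E : {set {set 'I_n}}, pred (labelling E)) :
  0 <= p <= 1 -> ordered_Gnp_prob p A <= 1.
Proof.
move=> p01; rewrite -(mean1 n p); apply: ler_sum => E _.
rewrite ler_wpM2l ?Gnp_weight_ge0 // /ordering_prob.
have [->|c0] := posnP #|edge_orderings E|; first by rewrite invr0 mulr0.
rewrite ler_pdivrMr ?ltr0n // mul1r ler_nat; apply: subset_leq_card.
by apply/subsetP => f; rewrite !inE => /andP[].
Qed.

Lemma le_thirds (x y z tau : R) : x <= tau / 3 -> y <= tau / 3 -> z <= tau / 3 ->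
  x + y + z <= tau.
Proof. by lra. Qed.

Lemma truncn_bounds (x : R) : 0 <= x ->
  (Num.truncn x)%:R <= x /\ x - 1 < (Num.truncn x)%:R.
Proof.
move=> x0; split; first by rewrite truncn_le.
by rewrite ltrBlDr natr1 truncnS_gt.
Qed.

(** The gap [d - p * n] is at least [eta * n / 2], so the second quantity is at most
    [4 * B * p / eta ^+ 2]. *)
Lemma dead_bound (B eta tau d n p : R) : 0 < B -> 0 < eta -> 0 < p -> 0 < n ->
    4 <= eta * n -> eta * n - 1 < d -> p <= eta / 4 ->
    p <= tau * eta ^+ 2 / (12 * B) ->
  p * n < d /\ B * (n * (p * n / (d - p * n) ^+ 2)) <= tau / 3.
Proof.
move=> B0 eta0 p0 n0 n_eta d_gt p_eta p_tau.
have pn_eta : p * n <= eta * n / 4 by rewrite mulrAC ler_pM2r.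
have half : eta * n / 2 <= d - p * n by lra.
have en0 : 0 < eta * n / 2 by lra.
have dn0 : 0 < d - p * n by exact: lt_le_trans half.
split; first by rewrite -subr_gt0.
have sq : (d - p * n) ^- 2 <= (eta * n / 2) ^- 2.
  by rewrite lef_pV2 ?posrE ?exprn_gt0 // ler_sqr // nnegrE ltW.
have Bp : 0 <= B * n * (p * n) by rewrite !mulr_ge0 // ltW.
rewrite !mulrA -[_ * _ * n]mulrA.
apply: le_trans (ler_wpM2l Bp sq) _.
rewrite [leLHS](_ : _ = 4 * B * p / eta ^+ 2); last by field; rewrite !gt_eqF.
rewrite ler_pdivrMr ?exprn_gt0 //; move: p_tau; rewrite ler_pdivlMr ?mulr_gt0 //.
by clear; lra.
Qed.

(** Used vertices and dead pairs each take at most [eta * n]; on the remaining [(1 - 2 * eta) * n],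
    compare $p \le Nq$ with the upper bound on [N]. *)
Lemma rate_bound (eta p q Q n rho N d : R) : 0 < eta -> eta <= 1 / 8 -> 0 < p ->
    0 < q -> 0 < Q -> 0 < n -> 0 <= rho -> d <= eta * n -> p <= N * q ->
    p * (rho * Q) <= eta -> N <= Q * (1 - eta) * (1 - 2 * eta) * (n * p) ->
  1 <= (1 - eta) * q * Q * (n - (rho * N + d)).
Proof.
move=> eta0 eta1 p_gt0 q0 Q0 n0 rho0 d_le q_ge p_rho N_le.
have e1' : 0 <= 1 - eta by clear - eta1; lra.
have e2' : 0 <= 1 - 2 * eta by clear - eta1; lra.
have N_le' : N <= Q * (n * p).
  apply: le_trans N_le _; rewrite ler_wpM2r ?mulr_ge0 ?(ltW n0) ?(ltW p_gt0) //.
  by rewrite -mulrA ler_piMr ?(ltW Q0) //; clear - eta0 eta1; nra.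
have rN : rho * N <= eta * n.
  apply: le_trans (ler_wpM2l rho0 N_le') _.
  rewrite [leLHS](_ : _ = p * (rho * Q) * n); last by ring.
  by rewrite ler_wpM2r // ltW.
have left_n : (1 - 2 * eta) * n <= n - (rho * N + d) by clear - rN d_le; lra.
apply: le_trans (ler_wpM2l _ left_n); last by rewrite !mulr_ge0 // ltW.
rewrite -(ler_pM2l p_gt0) mulr1; apply: le_trans q_ge _.
apply: le_trans (ler_wpM2r (ltW q0) N_le) _.
by rewrite le_eqVlt; apply/orP; left; apply/eqP; ring.
Qed.

(** The multiplicative losses amount to $(1-\eta)^3(1-2\eta) \ge 1 - 5\eta$; the two roundings cost
    at most $2l \le 2\eta x \le e\eta x$. *)
Lemma length_bound (eta e c l Q T x m L : R) : 0 < eta -> eta <= 1 / 8 -> 2 <= e ->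
    0 < l -> 0 < T -> 0 < x -> (1 - eta) * e * T <= l * Q ->
    c * T = Q * (1 - eta) * (1 - 2 * eta) -> l <= eta * x ->
    c * x - 1 < m -> (1 - eta) * m - 1 < L ->
  (1 - 8 * eta) * e * x <= L * l.
Proof.
move=> eta0 eta1 e2 l0 T0 x0 aT cT l_le m_gt L_gt.
have e1' : 0 <= 1 - eta by clear - eta1; lra.
have e2' : 0 <= 1 - 2 * eta by clear - eta1; lra.
have cl : (1 - eta) ^+ 3 * (1 - 2 * eta) * e <= (1 - eta) * (c * l).
  rewrite -(ler_pM2r T0).
  have f0 : 0 <= (1 - eta) ^+ 2 * (1 - 2 * eta) by rewrite mulr_ge0 ?sqr_ge0.
  have := ler_wpM2l f0 aT.
  rewrite [X in X <= _ -> _](_ : _ =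
    (1 - eta) ^+ 3 * (1 - 2 * eta) * e * T); last by ring.
  move/le_trans; apply.
  rewrite [leRHS](_ : _ = (1 - eta) * (c * T) * l); last by ring.
  by rewrite cT le_eqVlt; apply/orP; left; apply/eqP; ring.
have poly : 1 - 5 * eta <= (1 - eta) ^+ 3 * (1 - 2 * eta).
  by clear - eta0 eta1; nra.
have L_ge : ((1 - eta) * (c * x) - 2) * l <= L * l.
  rewrite ler_wpM2r ?(ltW l0) //.
  have H := ler_wpM2l e1' (ltW m_gt).
  by clear - H L_gt eta0; lra.
apply: le_trans L_ge.
have H1 : (1 - 5 * eta) * e <= (1 - eta) * (c * l).
  by apply: le_trans cl; rewrite ler_wpM2r // (le_trans _ e2).
have H2 := ler_wpM2r (ltW x0) H1.
have ex0 : 0 < eta * x by rewrite mulr_gt0.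
have H3 : 2 * (eta * x) <= e * (eta * x) by rewrite ler_pM2r.
by clear - H2 H3 ex0 l_le; lra.
Qed.

(** The failure bound has a Chebyshev, a collision and a dead-pair term; [M], [K] and [p0]
    respectively make each at most [tau / 3]. *)
Lemma ordered_Gnp_prob_large (eta tau : R) : 0 < eta -> eta <= 1 / 8 -> 0 < tau ->
  exists K p0 : R, 0 < p0 /\ forall n (p : R), 0 < p -> p <= p0 -> K <= n%:R * p ->
    1 - tau <= ordered_Gnp_prob p (fun (E : {set {set 'I_n}}) (f : labelling E) =>
       (1 - 8 * eta) * expR 1 * n%:R * p <= (longest_increasing_path f)%:R).
Proof.
move=> eta0 eta1 tau0; have e1 : 2 <= expR 1 :> R by have := expR_ge1Dx (1 : R); lra.
have [||l [Q [T [l0 Q0 T0 bin_ge aT]]]] := @exists_growth_constants R ((1 - eta) * expR 1).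
- by rewrite mulr_gt0 //; lra.
- by rewrite gtr_pMl //; lra.
have lR : 0 < l%:R :> R by rewrite ltr0n.
have QR : 0 < Q%:R :> R by rewrite ltr0n.
have TR : 0 < T%:R :> R by rewrite ltr0n.
have eta2 : 0 < eta ^+ 2 by rewrite exprn_gt0.
have [B BE B0] : exists2 B : R, B = T%:R / eta & 0 < B.
  by exists (T%:R / eta) => //; rewrite divr_gt0.
pose M := (Num.truncn (3 * B * l%:R / (eta ^+ 2 * tau))).+1.
have M0 : 0 < M%:R :> R by rewrite ltr0n.
have M_ge : B * (l%:R * (eta ^+ 2 * M%:R)^-1) <= tau / 3.
  have : 3 * B * l%:R / (eta ^+ 2 * tau) <= M%:R by rewrite ltW // truncnS_gt.
  rewrite ler_pdivrMr ?mulr_gt0 // => H.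
  by rewrite mulrA ler_pdivrMr ?mulr_gt0 //; lra.
have M_gt0 : (0 < M)%N by [].
move: M M0 M_ge M_gt0 => M M0 M_ge M_gt0.
pose rho := (\sum_(k < l.+1) stratum l Q M T k)%N.
(* About [c * n * p] blocks will be run; the two losses pay for the Chebyshev margin and for used
   vertices and dead pairs. *)
pose c := Q%:R * (1 - eta) * (1 - 2 * eta) / T%:R.
have c0 : 0 < c by rewrite divr_gt0 // !mulr_gt0 //; lra.
(* Since [q] will be at most $4/(Tcn)$, the collision term is at most [D / n]. *)
pose D := B * l%:R * rho%:R ^+ 2 * (4 / (T%:R * c)) ^+ 2.
have D0 : 0 <= D.
  by apply: mulr_ge0 (sqr_ge0 _); apply: mulr_ge0 (sqr_ge0 _); rewrite mulr_ge0 // ltW.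
(* The summands serve, in order, the dead-degree bound, the rounding of the number of blocks,
   collisions, the rounding of the length, and room for the starting vertices. *)
pose K := 4 / eta + 2 / c + 3 * D / tau + l%:R / eta + (stratum l Q M 0 0)%:R.
pose p0 := Num.min (1 / 2) (Num.min (eta / (rho%:R * Q%:R + 1))
   (Num.min (eta / 4) (tau * eta ^+ 2 / (12 * B)))).
have rQ : 0 < rho%:R * Q%:R + 1 :> R by rewrite ltr_wpDl // mulr_ge0.
exists K, p0; split.
  rewrite /p0 !lt_min; apply/and4P; split; [lra | by rewrite divr_gt0 | lra |].
  by apply: divr_gt0; apply: mulr_gt0.
move=> n p p_gt0; rewrite /p0 !le_min => /and4P[p_half p_rho p_eta p_tau] Knp.
have np_n : n%:R * p <= n%:R by rewrite ler_piMr //; lra.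
have D3 : 0 <= 3 * D / tau by apply: divr_ge0; [exact: mulr_ge0 | exact: ltW].
have k1 : 0 < 4 / eta by rewrite divr_gt0.
have k2 : 0 < 2 / c by rewrite divr_gt0.
have k3 : 0 < l%:R / eta by rewrite divr_gt0.
have k4 : 0 <= (stratum l Q M 0 0)%:R :> R by [].
have n_eta : 4 <= eta * n%:R.
  by rewrite mulrC -ler_pdivrMr //; rewrite /K in Knp; clear - Knp np_n D3 k1 k2 k3 k4; lra.
have np_c : 2 <= c * (n%:R * p).
  by rewrite mulrC -ler_pdivrMr //; rewrite /K in Knp; clear - Knp np_n D3 k1 k2 k3 k4; lra.
have n_D : 3 * D <= n%:R * tau.
  by rewrite -ler_pdivrMr //; rewrite /K in Knp; clear - Knp np_n D3 k1 k2 k3 k4; lra.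
have np_l : l%:R <= eta * (n%:R * p).
  by rewrite mulrC -ler_pdivrMr //; rewrite /K in Knp; clear - Knp np_n D3 k1 k2 k3 k4; lra.
have n_stratum : (stratum l Q M 0 0 <= n)%N.
  by rewrite -(ler_nat R); rewrite /K in Knp; clear - Knp np_n D3 k1 k2 k3 k4; lra.
have n0 : 0 < n%:R :> R.
  by rewrite -(pmulr_rgt0 _ eta0) (lt_le_trans _ n_eta).
clear K Knp D3 k1 k2 k3 k4 p0.
pose m := Num.truncn (c * (n%:R * p)).
have [m_le m_gt] := truncn_bounds (le_trans (ler0n R 2) np_c).
have m0 : (0 < m)%N by rewrite -(ltr_nat R); clear - np_c m_gt; lra.
have mR : 0 < m%:R :> R by rewrite ltr0n.
pose N := (m * T)%N.
have N0 : (0 < N)%N by rewrite muln_gt0 m0.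
have NR : 0 < N%:R :> R by rewrite ltr0n.
have N_le : N%:R <= Q%:R * (1 - eta) * (1 - 2 * eta) * (n%:R * p).
  rewrite /N natrM -ler_pdivlMr // -[leRHS]mulrAC.
  by rewrite [leRHS](_ : _ = c * (n%:R * p)) // /c; ring.
have N_ge : T%:R * c * (n%:R * p) / 2 <= N%:R.
  rewrite [leLHS](_ : _ = T%:R * (c * (n%:R * p) / 2)); last by ring.
  by rewrite /N natrM [leRHS]mulrC ler_pM2l //; clear - np_c m_gt; lra.
have [q [q01 qN q_ge q_le]] := exists_round_prob p_gt0 p_half N0.
have q0 : 0 < q by case/andP: q01.
have Tc : 0 < T%:R * c by rewrite mulr_gt0.
have q_n : q <= 4 / (T%:R * c) / n%:R.
  have : T%:R * c * n%:R * q <= 4.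
    have : p * (T%:R * c * n%:R * q) <= p * 4.
      have Nq : (T%:R * c * (n%:R * p) / 2) * q <= N%:R * q by rewrite ler_wpM2r // ltW.
      clear - q_le Nq; lra.
    by rewrite ler_pM2l.
  by move=> H; rewrite !ler_pdivlMr //; clear - H; lra.
pose d := Num.truncn (eta * n%:R).
have [d_le d_gt] := truncn_bounds (le_trans (ler0n R 4) n_eta).
pose L0 := Num.truncn ((1 - eta) * m%:R).
have em0 : 0 <= (1 - eta) * m%:R by rewrite mulr_ge0 //; clear - eta1; lra.
have [L_le L_gt] := truncn_bounds em0.
have rate : 1 <= (1 - eta) * q * Q%:R * (n%:R - (rho * N + d)%:R).
  rewrite natrD natrM; apply: (rate_bound eta0 eta1 p_gt0) => //.
  move: p_rho; rewrite ler_pdivlMr // mulrDr mulr1; clear - p_gt0; lra.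
have [pd dead_le] := dead_bound B0 eta0 p_gt0 n0 n_eta d_gt p_eta p_tau.
have eta01 : 0 < eta <= 1 by clear - eta0 eta1; lra.
have := ordered_Gnp_lower q01 eta01 Q0 M_gt0 T0 (leqnn rho) rate bin_ge n_stratum m0 eta0 L_le.
rewrite -/N qN -BE => /(_ pd) low.
have L_long : (1 - 8 * eta) * expR 1 * n%:R * p <= (L0 * l)%:R.
  rewrite natrM -[leLHS]mulrA.
  apply: (length_bound eta0 eta1 e1 lR TR _ aT _ np_l m_gt L_gt).
    by rewrite mulr_gt0.
  by rewrite /c divfK ?gt_eqF.
apply: le_trans (ordered_Gnp_prob_mono (A := fun (E : {set {set 'I_n}}) (f : labelling E) =>
  (L0 * l <= longest_increasing_path f)%N) _ _); last first.
- by move=> E f Lf; apply: le_trans L_long _; rewrite ler_nat.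
- by rewrite ltW //=; clear - p_half; lra.
apply: le_trans low; rewrite lerD2l lerN2 /failure_rate mulrDr mulrDr mulrDr.
apply: le_thirds => //.
- have q2 : q ^+ 2 <= (4 / (T%:R * c)) ^+ 2 / n%:R ^+ 2.
    by rewrite -expr_div_n ler_sqr ?nnegrE ?(ltW q0) // (le_trans (ltW q0)).
  have Bn : 0 <= B * l%:R * n%:R * rho%:R ^+ 2.
    by apply: mulr_ge0 (sqr_ge0 _); rewrite !mulr_ge0 // ltW.
  rewrite [leLHS](_ : _ = B * l%:R * n%:R * rho%:R ^+ 2 * q ^+ 2); last by ring.
  apply: le_trans (ler_wpM2l Bn q2) _.
  rewrite [leLHS](_ : _ = D / n%:R); last by rewrite /D; field; rewrite !gt_eqF.
  by rewrite ler_pdivrMr //; clear - n_D; lra.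
Qed.

End LargeProbability.

(** * Passage to the limit *)

Import numFieldNormedType.Exports.
Local Open Scope classical_set_scope.

Theorem theorem1p2 (R : realType) (eps : R) (p : nat -> R)
    (eps_gt0 : 0 < eps)
    (p_prob : forall n : nat, 0 <= p n <= 1)
    (p_lower : much_less (fun n : nat => ln (n%:R : R) / n%:R) p)
    (p_upper : much_less p (fun _ : nat => 1)) :
  whp (fun n : nat => ordered_Gnp_prob (p n)
    (fun (E : {set {set 'I_n}}) (f : labelling E) =>
       (1 - eps) * expR 1 * n%:R * p n
         <= (longest_increasing_path f)%:R)).
Proof.
rewrite /whp; apply/cvgrPdist_le => tau tau0.
(* The finite bound loses [8 * eta], which must not exceed [eps]. *)
pose eta := Num.min eps 1 / 8.
have eta0 : 0 < eta by rewrite divr_gt0 // lt_min eps_gt0 ltr01.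
have eta1 : eta <= 1 / 8 by rewrite ler_pM2r ?invr_gt0 // ge_min lexx orbT.
have eta_eps : 8 * eta <= eps by rewrite mulrC divfK ?gt_eqF // ge_min lexx.
have [K [p0 [p0_gt0 large]]] := ordered_Gnp_prob_large eta0 eta1 tau0.
have [p_neq0 /cvgrPdist_lt p_large] := p_lower.
have [_ /cvgrPdist_lt p_small] := p_upper.
have K1 : 0 < `|K| + 1 by rewrite ltr_wpDl.
have K1V : 0 < (`|K| + 1)^-1 by rewrite invr_gt0.
near=> n.
have pn0 : 0 < p n.
  rewrite lt_def (andP (p_prob n)).1 andbT.
  by near: n.
have pn_p0 : p n <= p0.
  have : `|0 - p n / 1| < p0 by near: n; exact: p_small.
  by rewrite sub0r normrN divr1 gtr0_norm // => /ltW.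
have n_e : expR 1 <= n%:R :> R by near: n; exact: nbhs_infty_ger.
have n0 : 0 < n%:R :> R by exact: lt_le_trans (expR_gt0 _) n_e.
have ln_n : 1 <= ln n%:R :> R by rewrite -[leLHS]expRK ler_ln ?posrE ?expR_gt0.
(* As $\ln n \ge 1$, a ratio $\ln n/(np)$ below $1/(|K|+1)$ gives $np \ge |K|+1$; the absolute value
   keeps the threshold positive. *)
have Kn : K <= n%:R * p n.
  have : `|0 - ln n%:R / n%:R / p n| < (`|K| + 1)^-1.
    by near: n; exact: p_large.
  have np0 : 0 < n%:R * p n by rewrite mulr_gt0.
  rewrite sub0r normrN ger0_norm; last by rewrite !divr_ge0 ?ltW // (lt_le_trans ltr01).
  rewrite -mulrA -invfM ltr_pdivrMr // mulrC ltr_pdivlMr // => /ltW.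
  apply: le_trans; apply: le_trans (ler_norm K) _.
  apply: (@le_trans _ _ (`|K| + 1)); first by rewrite lerDl.
  by rewrite ler_peMl // ltW.
have lower := large n (p n) pn0 pn_p0 Kn.
rewrite ger0_norm ?subr_ge0 ?ordered_Gnp_prob_le1 // lerBlDl -lerBlDr.
apply: le_trans lower _; apply: ordered_Gnp_prob_mono => // E f; apply: le_trans.
by do 3 (apply: ler_wpM2r; first by rewrite ?expR_ge0 // ltW); rewrite lerD2l lerN2.
Unshelve. all: by end_near.
Qed.
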